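(* Let $\mathcal{W}\subset\mathbb{R}$ be an interval of finite length $W=|\mathcal{W}|$, let $T>0$ and $I_T=[-T/2,T/2]$, and assume $WT\le 1$. Let $h\in L^2(\mathcal{W})$ with $h\ge 0$, and define $g\in PW(\mathcal{W})$ by $\widehat g=h$. Then $$\int_{I_T}|f(t)|^2\,dt\le\int_{I_T}|g(t)|^2\,dt\qquad\text{for every } f\in\mathcal{A}(h),$$ where $\mathcal{A}(h)=\{f\in PW(\mathcal{W}):|\widehat f|=h\text{ a.e.}\}$. Thus $g$ (which has constant spectral phase) is a maximizer of $f\mapsto\int_{I_T}|f(t)|^2\,dt$ within the class $\mathcal{A}(h)$.
   Context: The Fourier transform of $f\in L^2(\mathbb{R})$ is (the $L^2$-extension of) $\widehat f(w)=\int_{\mathbb{R}}f(t)e^{-2\pi i w t}\,dt$. For a bounded interval $\mathcal{W}\subset\mathbb{R}$, the Paley--Wiener space is $PW(\mathcal{W})=\{f\in L^2(\mathbb{R}):\widehat f=0\text{ a.e. outside }\mathcal{W}\}$. Functions in $L^2(\mathcal{W})$ are extended by zero outside $\mathcal{W}$. *)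

(* Defs.v *)
From mathcomp Require Import all_boot all_order all_algebra.
From mathcomp Require Import complex.
From mathcomp Require Import all_classical all_reals all_analysis.

Set Implicit Arguments.
Unset Strict Implicit.
Unset Printing Implicit Defensive.

Import Order.TTheory GRing.Theory Num.Theory.

Local Open Scope classical_set_scope.
Local Open Scope ring_scope.
Local Open Scope complex_scope.

Section Fourier.
Variable R : realType.

Local Notation mu := (@lebesgue_measure R).

(* R[i] carries no sigma-algebra in the libraries, so measurability and
   integrals of complex-valued functions are taken componentwise. *)
Definition cmeasurable_fun (D : set R) (f : R -> R[i]) : Prop :=
  measurable_fun D (fun t => complex.Re (f t)) /\
  measurable_fun D (fun t => complex.Im (f t)).

Definition cintegrable (D : set R) (f : R -> R[i]) : Prop :=
  mu.-integrable D (fun t => (complex.Re (f t))%:E) /\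
  mu.-integrable D (fun t => (complex.Im (f t))%:E).

Definition cintegral (D : set R) (f : R -> R[i]) : R[i] :=
  Rintegral mu D (fun t => complex.Re (f t)) +i*
  Rintegral mu D (fun t => complex.Im (f t)).

Definition energy (D : set R) (f : R -> R[i]) : \bar R :=
  (\int[mu]_(t in D) ((Normc.normc (f t)) ^+ 2)%:E)%E.

Definition L2 (D : set R) (f : R -> R[i]) : Prop :=
  cmeasurable_fun D f /\ (energy D f < +oo)%E.

Definition cexpi (x : R) : R[i] := cos x +i* sin x.

Definition fourier_integral (f : R -> R[i]) (w : R) : R[i] :=
  cintegral setT (fun t => f t * cexpi (- (2 * pi * w * t))).

(* [is_fourier f F]: the class of F is the Fourier transform of the class of f,
   i.e. (f, F) lies in the L2-closure of the graph of the Fourier integral on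
   L1 `&` L2. By Plancherel's theorem this relation is defined on all of L2 and
   determines F up to a null set, so that asking for some F or for all F
   amounts to the same thing. *)
Definition is_fourier (f F : R -> R[i]) : Prop :=
  [/\ L2 setT f, L2 setT F &
    exists u : nat -> R -> R[i],
      [/\ forall n, cintegrable setT (u n) /\ L2 setT (u n),
          (fun n => energy setT (fun t => u n t - f t)) @ \oo --> (0 : \bar R)%E &
          (fun n => energy setT (fun w => fourier_integral (u n) w - F w))
            @ \oo --> (0 : \bar R)%E]].

Definition PW (W : set R) : set (R -> R[i]) :=
  [set f | exists F, is_fourier f F /\ {ae mu, forall w, ~ W w -> F w = 0}].

Definition zero_ext (W : set R) (h : R -> R) : R -> R := patch (fun=> 0) W h.

(* The class A(h). *)
Definition spectral_class (W : set R) (h : R -> R) : set (R -> R[i]) :=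
  [set f | PW W f /\
    exists F, is_fourier f F /\ {ae mu, forall w, Normc.normc (F w) = zero_ext W h w}].

Definition centered_itv (T : R) : set R := `[- (T / 2), T / 2].

End Fourier.

(* Main.v *)
Require Import Defs.
From mathcomp Require Import all_boot all_order all_algebra.
From mathcomp Require Import complex.
From mathcomp Require Import all_classical all_reals all_analysis.
From mathcomp Require Import measurable_realfun.
From mathcomp Require Import ring lra.

Import Order.TTheory GRing.Theory Num.Theory.
Import numFieldNormedType.Exports.

Local Open Scope classical_set_scope.
Local Open Scope ring_scope.
Local Open Scope complex_scope.

(** Write [F = A +i* B] for the spectrum of [f]. Since [F] vanishes outside [J],
    it is integrable and [f] is almost everywhere its inverse transform, so that
    expanding the square and integrating over [I_T] gives
<<
      energy I_T f = \int\int Re (F w * conj (F v)) K (w - v) dv dw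
>>
    with [K u = \int_(I_T) cos (2 pi u t) dt = sin (pi u T) / (pi u)]. Two
    points of [J] are at distance at most [W <= 1 / T], and there
    [pi |u| T <= pi] makes [K] nonnegative. Hence
    [Re (F w * conj (F v)) <= |F w| |F v| = h w * h v] can be integrated against
    [K], and the bound is the energy of [g], whose spectrum is [h] itself
    ([energy_form], [energy_form_le]).

    The remaining work is Fourier inversion ([spectrum_inversion]), for a
    transform that is only known as a mean-square limit of Fourier integrals of
    functions [u_n]. Weighting the spectrum by Abel's factor [exp (- e |w|)]
    turns, by Fubini, the inversion integral of each [u_n] into its Poisson
    integral ([abel_mean_transform]). Both sides are pairings with
    square-integrable functions, so the identity passes to the limit
    ([abel_mean_spectrum]). Pointwise convergence of Poisson integrals as [e]
    tends to 0 is avoided by first integrating over a segment [`[a, b]]: the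
    Poisson kernel integrated over a segment is a difference of arctangents,
    which tends boundedly to the indicator function
    ([Rintegral_inverse_transform]). Equality of all integrals over segments
    then gives equality almost everywhere by Lebesgue differentiation.

    Everything is carried out on real and imaginary parts. Both the transform
    and its inverse are expressed by one real cosine-sine transform [ctrans], and
    multiplying by [- 'i] reduces imaginary parts to real parts. *)

(** * Integrable functions on the line, Fubini and reflection *)

Section Basics.
Context {R : realType}.
Local Notation mu := (@lebesgue_measure R).
Local Notation intg f := (mu.-integrable setT (EFin \o f)).
Implicit Types (f g h k : R -> R).

Lemma ae_mono (P Q : R -> Prop) : (forall x, P x -> Q x) ->
  {ae mu, forall x, P x} -> {ae mu, forall x, Q x}.
Proof.
move=> PQ; apply: filterS; first exact: (ae_filter_ringOfSetsType mu).
exact: PQ.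
Qed.

Lemma ae_and (P Q : R -> Prop) : {ae mu, forall x, P x} ->
  {ae mu, forall x, Q x} -> {ae mu, forall x, P x /\ Q x}.
Proof.
move=> aP aQ; apply: filterS2 aP aQ; first exact: (ae_filter_ringOfSetsType mu).
by move=> x; exact: conj.
Qed.

Lemma intg_measurable f : intg f -> measurable_fun setT f.
Proof. by move=> /integrableP[/measurable_EFinP]. Qed.

Lemma le_intg f g : measurable_fun setT f -> (forall x, `|f x| <= g x) ->
  intg g -> intg f.
Proof.
move=> mf fg; apply: le_integrable => //; first exact/measurable_EFinP.
by move=> x _ /=; rewrite lee_fin (le_trans (fg x))// ler_norm.
Qed.

Lemma intgD f g : intg f -> intg g -> intg (fun x => f x + g x).
Proof. by move=> intf intgg; have := integrableD measurableT intf intgg. Qed.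

Lemma intgB f g : intg f -> intg g -> intg (fun x => f x - g x).
Proof. by move=> intf intgg; have := integrableB measurableT intf intgg. Qed.

Lemma intgZ c f : intg f -> intg (fun x => c * f x).
Proof. by move=> intf; have := integrableZl measurableT c intf. Qed.

Lemma intg_bounded_mul f k (M : R) : intg f -> measurable_fun setT k ->
  (forall x, `|k x| <= M) -> intg (fun x => f x * k x).
Proof.
move=> intf mk kM; apply: (@le_intg _ (fun x => M * `|f x|)).
- by apply: measurable_funM => //; exact: intg_measurable.
- by move=> x; rewrite normrM mulrC ler_wpM2r.
- exact/intgZ/(integrable_norm intf).
Qed.

Lemma RintegralTZl c f : intg f -> \int[mu]_x (c * f x) = c * \int[mu]_x f x.
Proof. exact: RintegralZl. Qed.

Lemma RintegralTD f g : intg f -> intg g ->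
  \int[mu]_x (f x + g x) = \int[mu]_x f x + \int[mu]_x g x.
Proof. exact: RintegralD. Qed.

Lemma RintegralTB f g : intg f -> intg g ->
  \int[mu]_x (f x - g x) = \int[mu]_x f x - \int[mu]_x g x.
Proof. exact: RintegralB. Qed.

Lemma ae_eq_Rintegral f g : measurable_fun setT f -> measurable_fun setT g ->
  {ae mu, forall x, f x = g x} -> \int[mu]_x f x = \int[mu]_x g x.
Proof.
move=> mf mg fg; congr fine; apply: ae_eq_integral => //; [exact/measurable_EFinP..|].
by apply: ae_mono fg => x /= ->.
Qed.

(** Replacing [g] by [max f g], which is almost everywhere equal to it, makes
    the inequality hold everywhere *)
Lemma ae_le_Rintegral f g : intg f -> intg g ->
  {ae mu, forall x, f x <= g x} -> \int[mu]_x f x <= \int[mu]_x g x.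
Proof.
move=> intf intgg fg.
have mf := intg_measurable _ intf; have mg := intg_measurable _ intgg.
have intm : intg (fun x => Num.max (f x) (g x)).
  apply: (@le_intg _ (fun x => `|f x| + `|g x|)).
  - exact: measurable_maxr.
  - by move=> x; rewrite maxEle; case: ifP => _; rewrite ?lerDl ?lerDr.
  - by apply: intgD; exact: integrable_norm.
rewrite (@ae_eq_Rintegral g (fun x => Num.max (f x) (g x)))//.
- by apply: le_Rintegral => // x _; rewrite le_max lexx.
- exact: measurable_maxr.
- apply: ae_mono fg => x; case: leP => // h1 h2; apply/eqP; rewrite eq_le h2 ltW.
Qed.

Section fubini.
Variables (a b : R -> R) (kappa : R * R -> R) (M : R).
Hypotheses (inta : intg a) (intb : intg b).
Hypotheses (mkappa : measurable_fun setT kappa).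
Hypothesis kappaM : forall z, `|kappa z| <= M.

Let f (z : R * R) : \bar R := (a z.1 * (b z.2 * kappa z))%:E.

Let mf : measurable_fun setT f.
Proof.
apply/measurable_EFinP; apply: measurable_funM.
  by apply: measurableT_comp => //; exact: intg_measurable.
apply: measurable_funM => //.
by apply: measurableT_comp => //; exact: intg_measurable.
Qed.

Let M0 : 0 <= M. Proof. exact: le_trans (kappaM (0, 0)). Qed.

Let kappa_section x : measurable_fun setT (fun y => kappa (x, y)).
Proof. by apply: measurableT_comp => //; exact: measurable_pair1. Qed.

Let kappa_section2 y : measurable_fun setT (fun x => kappa (x, y)).
Proof. by apply: measurableT_comp => //; exact: measurable_pair2. Qed.

Let intb_section x : intg (fun y => b y * kappa (x, y)).
Proof. exact: (@intg_bounded_mul _ _ M). Qed.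

Let inta_section y : intg (fun x => a x * kappa (x, y)).
Proof. exact: (@intg_bounded_mul _ _ M). Qed.

Let intf : (mu \x mu)%E.-integrable setT f.
Proof.
apply/integrable12ltyP => //.
pose Mb := M * \int[mu]_y `|b y|.
apply: (@le_lt_trans _ _ (\int[mu]_x (`|a x| * Mb)%:E)%E).
  apply: ge0_le_integral => //.
  - by move=> x _; exact: integral_ge0.
  - have mnf : measurable_fun setT (fun z => `|f z|%E) by exact: measurableT_comp.
    by apply: (measurable_fun_fubini_tonelli_F (m2 := mu) (fun z => `|f z|%E) mnf).
  - apply/measurable_EFinP; apply: measurable_funM => //.
    by apply: measurableT_comp => //; exact: intg_measurable.
  move=> x _.
  have intM : intg (fun y => `|a x| * M * `|b y|).
    by apply: intgZ; exact: integrable_norm.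
  apply: (@le_trans _ _ (\int[mu]_y (`|a x| * M * `|b y|)%:E)%E).
    apply: ge0_le_integral => //.
    - apply: measurableT_comp => //; apply/measurable_EFinP.
      exact: (intg_measurable _ (intgZ (a x) _ (intb_section x))).
    - by apply/measurable_EFinP; exact: (intg_measurable _ intM).
    - move=> y _; rewrite /f/= lee_fin !normrM -mulrA ler_wpM2l//.
      by rewrite mulrC ler_wpM2r.
  rewrite -[leLHS]fineK; last exact: (integrable_fin_num measurableT intM).
  rewrite lee_fin -/(Rintegral _ _ _) RintegralTZl; last exact: integrable_norm.
  by rewrite mulrA.
have := integrable_lty measurableT (intgZ Mb _ (integrable_norm inta)).
by under eq_integral do rewrite /= mulrC.
Qed.

Let FE x : (\int[mu]_y f (x, y))%E = (a x * \int[mu]_y (b y * kappa (x, y)))%:E.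
Proof.
rewrite -RintegralTZl// /Rintegral fineK//.
by apply: (integrable_fin_num measurableT); apply: intgZ.
Qed.

Let GE y : (\int[mu]_x f (x, y))%E = (b y * \int[mu]_x (a x * kappa (x, y)))%:E.
Proof.
rewrite -RintegralTZl// /Rintegral fineK//; last first.
  by apply: (integrable_fin_num measurableT); apply: intgZ.
by apply: eq_integral => x _; rewrite /f/= mulrCA.
Qed.

(** [a] and [b] being integrable and [kappa] bounded, [a x * b y * kappa (x, y)]
    is integrable for the product measure, whence this lemma and the next *)
Lemma intg_kernel : intg (fun x => a x * \int[mu]_y (b y * kappa (x, y))).
Proof.
have := integrable_fubini_F intf; apply: eq_integrable => // x _.
exact: FE.
Qed.

Lemma Rintegral_Fubini :
  \int[mu]_x (a x * \int[mu]_y (b y * kappa (x, y))) =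
  \int[mu]_y (b y * \int[mu]_x (a x * kappa (x, y))).
Proof.
rewrite /Rintegral; congr fine.
transitivity (\int[mu]_x \int[mu]_y f (x, y))%E.
  by apply: eq_integral => x _; rewrite FE.
by rewrite Fubini//; apply: eq_integral => y _; rewrite GE.
Qed.

End fubini.

(** The image of Lebesgue measure under [x |-> - x] agrees with it on half-open
    segments, hence everywhere *)
Lemma RintegralTN f : intg f -> \int[mu]_x f (- x) = \int[mu]_x f x.
Proof.
move=> intf; rewrite /Rintegral; congr fine.
have mN : measurable_fun setT (@GRing.opp R : measurableTypeR R -> measurableTypeR R).
  exact: oppr_measurable.
have muN (A : set (measurableTypeR R)) : measurable A ->
    mu A = pushforward mu (@GRing.opp R : measurableTypeR R -> measurableTypeR R) A.
  apply: lebesgue_measure_unique => _ [[a b] _ <-]/=.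
  rewrite /pushforward (_ : _ @^-1` _ = `[- b, - a[%classic); last first.
    apply/seteqP; split => x /=; rewrite !in_itv/= => /andP[h1 h2].
      by rewrite lerNl h2 ltrNr h1.
    by rewrite ltrNr h2 lerNl h1.
  by rewrite !lebesgue_measure_itv/= !lte_fin ltrN2 opprK addrC.
transitivity (\int[pushforward mu (@GRing.opp R :
    measurableTypeR R -> measurableTypeR R)]_x (f (- x))%:E)%E.
  by apply: eq_measure_integral => A mA _; exact: muN.
rewrite (@integral_pushforward _ _ _ _ _ _ mN mu setT (fun x => (f (- x))%:E))//.
- by rewrite preimage_setT; apply: eq_integral => x _ /=; rewrite opprK.
- apply/measurable_EFinP; apply: measurableT_comp => //.
  exact: intg_measurable.
- by rewrite preimage_setT; apply: eq_integrable intf => // x _ /=; rewrite opprK.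
Qed.

Lemma Rintegral_odd f : intg f -> (forall x, f (- x) = - f x) ->
  \int[mu]_x f x = 0.
Proof.
move=> intf oddf; have := RintegralTN f intf.
rewrite (_ : (fun x => f (- x)) = (fun x => - 1 * f x)); last first.
  by apply/funext => x; rewrite oddf mulN1r.
by rewrite RintegralTZl// => h; lra.
Qed.

End Basics.

(** * Pairings of square-integrable functions *)

Section SquareIntegrable.
Context {R : realType}.
Local Notation mu := (@lebesgue_measure R).
Local Notation intg f := (mu.-integrable setT (EFin \o f)).
Implicit Types (f g h k : R -> R).

Lemma intg_mul f g : measurable_fun setT f -> measurable_fun setT g ->
  intg (fun x => f x ^+ 2) -> intg (fun x => g x ^+ 2) ->
  intg (fun x => f x * g x).
Proof.
move=> mf mg f2 g2; apply: (@le_intg _ _ (fun x => f x ^+ 2 + g x ^+ 2)).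
- exact: measurable_funM.
- move=> x; rewrite ler_norml; nra.
- exact: intgD.
Qed.

Lemma intg_sq_bounded f (M : R) : intg f -> (forall x, `|f x| <= M) ->
  intg (fun x => f x ^+ 2).
Proof.
move=> intf fM; have := intg_bounded_mul f f M intf (intg_measurable _ intf) fM.
by apply: eq_integrable.
Qed.

Lemma intgP f : measurable_fun setT f -> (forall x, 0 <= f x) ->
  (\int[mu]_x (f x)%:E < +oo)%E -> intg f.
Proof.
move=> mf f0 foo; apply/integrableP; split; first exact/measurable_EFinP.
by under eq_integral => x _ do rewrite /= ger0_norm//.
Qed.

(** The error is the integral of [(v n - f) * k]. A weighted arithmetic-geometric
    bound replaces the Cauchy-Schwarz inequality for integrals. *)
Lemma cvg_L2_pairing (v : nat -> R -> R) f k :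
  (forall n, measurable_fun setT (v n)) -> measurable_fun setT f ->
  measurable_fun setT k ->
  intg (fun x => f x ^+ 2) -> intg (fun x => k x ^+ 2) ->
  (\int[mu]_x ((v n x - f x) ^+ 2)%:E)%E @[n --> \oo] --> 0%E ->
  \int[mu]_x (v n x * k x) @[n --> \oo] --> \int[mu]_x (f x * k x).
Proof.
move=> mv mf mk f2 k2 /fine_cvgP[finv v0].
have intfk : intg (fun x => f x * k x) by exact: intg_mul.
apply/cvgrPdist_lt => e e0.
set K := \int[mu]_x (k x ^+ 2).
have K0 : 0 <= K by apply: Rintegral_ge0 => x _; exact: sqr_ge0.
(* the weight in the arithmetic-geometric bound [|x y| <= x ^ 2 / eta + eta * y ^ 2] *)
pose eta := e / (2 * (K + 1)).
have eta0 : 0 < eta by rewrite divr_gt0// mulr_gt0//; lra.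
have etaK : eta * K < e / 2.
  have -> : e / 2 = eta * (K + 1) by rewrite /eta; field; lra.
  by rewrite ltr_pM2l//; lra.
near=> n.
have int2 : intg (fun x => (v n x - f x) ^+ 2).
  apply: intgP => //.
  - by apply: measurable_funX; exact: measurable_funB.
  - by move=> x; exact: sqr_ge0.
  - by rewrite ltey_eq; apply/orP; left; near: n.
have intd : intg (fun x => (v n x - f x) * k x).
  by apply: intg_mul => //; exact: measurable_funB.
rewrite distrC (_ : _ - _ = \int[mu]_x ((v n x - f x) * k x)); last first.
  rewrite -RintegralTB//; first by apply: eq_Rintegral => x _; ring.
  have := intgD _ _ intd intfk; apply: eq_integrable => // x _ /=.
  by congr EFin; ring.
apply: (@le_lt_trans _ _ (eta^-1 * \int[mu]_x ((v n x - f x) ^+ 2) + eta * K)).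
  rewrite /K -RintegralTZl// -RintegralTZl// -RintegralTD//; [|exact: intgZ..].
  apply: le_trans (le_normr_Rintegral measurableT intd) _.
  apply: le_Rintegral => //; first exact: integrable_norm.
    by apply: intgD; exact: intgZ.
  move=> x _; rewrite normrM; set p := v n x - f x; set q := k x.
  rewrite -(real_normK (num_real p)) -(real_normK (num_real q)).
  have -> : eta^-1 * `|p| ^+ 2 + eta * `|q| ^+ 2 =
    eta * (`|p| / eta - `|q|) ^+ 2 + 2 * (`|p| * `|q|) by field; lra.
  have pq0 : 0 <= `|p| * `|q| by exact: mulr_ge0.
  have : 0 <= eta * (`|p| / eta - `|q|) ^+ 2 by rewrite mulr_ge0 ?sqr_ge0// ltW.
  move: pq0; set y := eta * _; set z := `|p| * _; lra.
have : eta^-1 * \int[mu]_x (v n x - f x) ^+ 2 < e / 2; last lra.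
rewrite mulrC ltr_pdivrMr//.
apply: le_lt_trans (ler_norm _) _; rewrite -normrN -sub0r.
near: n; move/cvgrPdist_lt : v0; apply.
by rewrite mulr_gt0// divr_gt0.
Unshelve. all: by end_near. Qed.

End SquareIntegrable.

(** * Abel's factor and the Poisson kernel *)

Section Poisson.
Context {R : realType}.
Local Notation mu := (@lebesgue_measure R).
Local Notation intg f := (mu.-integrable setT (EFin \o f)).
Implicit Types (e al : R).

Lemma is_derive_mull (r : R) (g : R -> R) (dg x : R) :
  is_derive x (1 : R) g dg -> is_derive x (1 : R) (fun y => r * g y : R) (r * dg).
Proof.
move=> h; have := @is_deriveM R R^o (cst r) g x 1 _ _ (is_derive_cst r x 1) h.
by rewrite scaler0 addr0 /GRing.scale.
Qed.

Lemma is_derive_scale (r x : R) : is_derive x (1 : R) (fun y => r * y : R) r.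
Proof. by have := is_derive_mull r id 1 x (is_derive_id x 1); rewrite mulr1. Qed.

Definition abel e (w : R) : R := expR (- (e * `|w|)).

(** The Fourier transform of [abel e]; up to the normalization of frequencies,
    the Poisson kernel of the upper half-plane at height [e] *)
Definition poisson e (u : R) : R := 2 * e / (e ^+ 2 + (2 * pi * u) ^+ 2).

Lemma poissonC e (t s : R) : poisson e (t - s) = poisson e (s - t).
Proof. by rewrite /poisson -(opprB s t) mulrN sqrrN. Qed.

Lemma continuous_abel e : continuous (abel e).
Proof.
move=> x; apply: continuous_comp; last exact: continuous_expR.
apply: continuousN; apply: continuousM; first exact: cst_continuous.
exact: norm_continuous.
Qed.

Lemma measurable_abel e : measurable_fun setT (abel e).
Proof. apply: continuous_measurable_fun; exact: continuous_abel. Qed.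

Lemma abel_gt0 e w : 0 < abel e w. Proof. exact: expR_gt0. Qed.

Lemma abel_le1 e w : 0 <= e -> abel e w <= 1.
Proof. by move=> e0; rewrite /abel expR_le1 oppr_le0 mulr_ge0. Qed.

Lemma normr_abel_le1 e w : 0 <= e -> `|abel e w| <= 1.
Proof. by move=> e0; rewrite ger0_norm ?abel_le1// ltW// abel_gt0. Qed.

(** An antiderivative of [exp (- e w) * (c + cos (al w))]. The constant [c]
    serves to make the integrand nonnegative, which the fundamental theorem of
    calculus on a half-line asks for. *)
Let anti e al c (w : R) : R :=
  expR (- (e * w)) * ((al * sin (al * w) - e * cos (al * w)) / (e ^+ 2 + al ^+ 2) - c / e).

Let is_derive_anti e al c (w : R) : 0 < e ->
  is_derive w (1 : R) (anti e al c) (expR (- (e * w)) * (c + cos (al * w))).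
Proof.
move=> e0; rewrite /anti.
have dexp : is_derive w (1 : R) (fun x : R => expR (- (e * x)))
    (expR (- (e * w)) * - e).
  have h : is_derive w (1 : R) (fun x : R => - (e * x)) (- e) by apply: is_deriveN; exact: is_derive_scale.
  exact: (@is_derive1_comp R expR (fun x => - (e * x)) w _ _ (is_derive_expR _) h).
have dcos : is_derive w (1 : R) (fun x : R => cos (al * x)) (- sin (al * w) * al).
  exact: (@is_derive1_comp R cos (fun x => al * x) w _ _ (is_derive_cos _) (is_derive_scale al w)).
have dsin : is_derive w (1 : R) (fun x : R => sin (al * x)) (cos (al * w) * al).
  exact: (@is_derive1_comp R sin (fun x => al * x) w _ _ (is_derive_sin _) (is_derive_scale al w)).
set D := e ^+ 2 + al ^+ 2.
have D0 : D != 0 by rewrite gt_eqF// ltr_wpDr ?sqr_ge0// exprn_gt0.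
have dnum : is_derive w (1 : R)
    (fun x => (al * sin (al * x) - e * cos (al * x)) / D - c / e)
    (al / D * (cos (al * w) * al) + - e / D * (- sin (al * w) * al)).
  rewrite (_ : (fun x => _) = (fun x => (al / D) * sin (al * x)) +
      (fun x => (- e / D) * cos (al * x)) + cst (- (c / e))); last first.
    by apply/funext => x; rewrite !fctE; field; rewrite D0 gt_eqF.
  rewrite -[X in is_derive _ _ _ X]addr0.
  by apply: is_deriveD; apply: is_deriveD; exact: is_derive_mull.
have := @is_deriveM R R^o _ _ w 1 _ _ dexp dnum.
have -> : expR (- (e * w)) *:
   (al / D * (cos (al * w) * al) + - e / D * (- sin (al * w) * al)) +
   ((al * sin (al * w) - e * cos (al * w)) / D - c / e) *:
   (expR (- (e * w)) * - e) = expR (- (e * w)) * (c + cos (al * w)) :> R.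
  rewrite /GRing.scale/=; move: D0; rewrite /D => D0; field.
  by rewrite D0 gt_eqF.
by [].
Qed.

Let cvg_anti e al c : 0 < e -> anti e al c w @[w --> +oo] --> (0 : R).
Proof.
move=> e0.
pose M := (`|al| + e) / (e ^+ 2 + al ^+ 2) + `|c / e|.
have De : 0 < e ^+ 2 + al ^+ 2 by rewrite ltr_wpDr ?sqr_ge0// exprn_gt0.
have antiM w : `|anti e al c w| <= M * expR (- (e * w)).
  rewrite /anti normrM ger0_norm ?expR_ge0// mulrC ler_wpM2r ?expR_ge0//.
  rewrite (le_trans (ler_normB _ _))// lerD2r normrM (ger0_norm (_ : 0 <= _^-1)); last first.
    by rewrite invr_ge0 ltW.
  rewrite ler_wpM2r ?invr_ge0// ?(ltW De)// (le_trans (ler_normB _ _))// lerD//.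
    by rewrite normrM ler_piMr// sin_max.
  by rewrite normrM (gtr0_norm e0) ler_piMr ?(ltW e0)// cos_max.
have exp0 : M * expR (- (e * w)) @[w --> +oo] --> (0 : R).
  rewrite -[X in _ --> X](mulr0 M); apply: cvgM; first exact: cvg_cst.
  apply: (@cvg_comp _ _ _ (fun w => e * w) (fun y => expR (- y)) _ +oo).
    exact: gt0_cvgMry => //; exact: cvg_id.
  exact: cvgr_expR.
apply/cvgr0Pnorm_lt => d d0.
move/cvgr0Pnorm_lt : exp0 => /(_ _ d0); apply: filterS => w.
exact/le_lt_trans/(le_trans (antiM w))/ler_norm.
Qed.

Let continuous_scale r : continuous (fun x : R => r * x).
Proof. by move=> x; apply: cvgM; [exact: cvg_cst|exact: cvg_id]. Qed.

Let continuous_ccos al c : continuous (fun x : R => c + cos (al * x)).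
Proof.
move=> x; apply: cvgD; first exact: cvg_cst.
by apply: continuous_comp; [exact: continuous_scale|exact: continuous_cos].
Qed.

Let integral_half e al c : 0 < e -> (forall w, 0 <= c + cos (al * w)) ->
  (\int[mu]_(w in `[0%R, +oo[) (expR (- (e * w)) * (c + cos (al * w)))%:E =
   (c / e + e / (e ^+ 2 + al ^+ 2))%:E)%E.
Proof.
move=> e0 c0.
have ge0 : forall x, 0 <= x -> 0 <= expR (- (e * x)) * (c + cos (al * x)).
  by move=> x _; rewrite mulr_ge0 ?expR_ge0.
have cF w : {for w, continuous (anti e al c)}.
  apply/differentiable_continuous/derivable1_diffP.
  by have [] := is_derive_anti e al c w e0.
rewrite (ge0_continuous_FTC2y ge0 _ (cvg_anti e al c e0)).
- rewrite /anti !mulr0 oppr0 expR0 sin0 cos0 mulr0 mulr1 -EFinB; congr EFin.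
  by field; rewrite !gt_eqF// ltr_wpDr ?sqr_ge0// exprn_gt0.
- apply: continuous_subspaceT => x; apply: cvgM; last exact: continuous_ccos.
  apply: continuous_comp; last exact: continuous_expR.
  by apply: cvgN; exact: continuous_scale.
- by move=> x _; have [] := is_derive_anti e al c x e0.
- by apply: cvg_at_right_filter; exact: cF.
- by move=> x _; rewrite derive1E; have [] := is_derive_anti e al c x e0.
Qed.

Let integral_line e al c : 0 < e -> (forall w, 0 <= c + cos (al * w)) ->
  (\int[mu]_w (abel e w * (c + cos (al * w)))%:E =
   (2 * (c / e + e / (e ^+ 2 + al ^+ 2)))%:E)%E.
Proof.
move=> e0 c0; rewrite ge0_symfun_integralT.
- rewrite EFinM; congr (_ * _)%E; rewrite -(integral_half e al c e0 c0) -set_itvcy.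
  apply: eq_integral => x; rewrite inE/= in_itv/= andbT => x0.
  by rewrite /abel ger0_norm.
- by move=> x; rewrite mulr_ge0// ltW// abel_gt0.
- by move=> x; apply: cvgM; [exact: continuous_abel|exact: continuous_ccos].
- by move=> x; rewrite /abel /= normrN mulrN cosN.
Qed.

Let measurable_line e al c :
  measurable_fun setT (fun w => abel e w * (c + cos (al * w))).
Proof.
apply: measurable_funM; first exact: measurable_abel.
by apply: continuous_measurable_fun; exact: continuous_ccos.
Qed.

Lemma intg_abel e : 0 < e -> intg (abel e).
Proof.
move=> e0.
have h0 : forall w : R, (0 : R) <= 0 + cos (0 * w).
  by move=> w; rewrite add0r mul0r cos0.
have eqa : abel e = (fun w => abel e w * (0 + cos (0 * w))).
  by apply/funext => w; rewrite add0r mul0r cos0 mulr1.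
apply: intgP; first exact: measurable_abel.
  by move=> w; rewrite ltW// abel_gt0.
by rewrite eqa integral_line// ltry.
Qed.

(** Difference of the integrals of [abel e w * (1 + cos _)] and [abel e w], both
    of nonnegative functions *)
Lemma Rintegral_abel_cos e u : 0 < e ->
  \int[mu]_w (abel e w * cos (2 * pi * u * w)) = poisson e u.
Proof.
move=> e0.
have h0 : forall w : R, (0 : R) <= 0 + cos (0 * w).
  by move=> w; rewrite add0r mul0r cos0.
have h1 : forall w : R, (0 : R) <= 1 + cos (2 * pi * u * w).
  by move=> w; rewrite -lerBlDl sub0r cos_geN1.
have e1 : \int[mu]_w (abel e w * (1 + cos (2 * pi * u * w))) =
    2 * (1 / e + e / (e ^+ 2 + (2 * pi * u) ^+ 2)).
  by rewrite /Rintegral integral_line.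
have e2 : \int[mu]_w abel e w = 2 / e.
  transitivity (\int[mu]_w (abel e w * (0 + cos (0 * w)))).
    by apply: eq_Rintegral => w _; rewrite add0r mul0r cos0 mulr1.
  by rewrite /Rintegral integral_line//=; field; rewrite gt_eqF.
have i1 : intg (fun w => abel e w * (1 + cos (2 * pi * u * w))).
  apply: intgP; first exact: measurable_line.
    by move=> w; rewrite mulr_ge0// ltW// abel_gt0.
  by rewrite integral_line// ltry.
transitivity (\int[mu]_w (abel e w * (1 + cos (2 * pi * u * w)) - abel e w)).
  by apply: eq_Rintegral => w _; ring.
rewrite RintegralTB ?e1 ?e2//; last exact: intg_abel.
rewrite /poisson; field; rewrite !gt_eqF// ltr_wpDr ?sqr_ge0// exprn_gt0//.
Qed.

End Poisson.

(** * The cosine-sine transform *)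

Section Ctrans.
Context {R : realType}.
Local Notation mu := (@lebesgue_measure R).
Local Notation intg f := (mu.-integrable setT (EFin \o f)).
Implicit Types (f g h k a b A B p : R -> R) (e c s w t u x : R).

Lemma intgN f : intg f -> intg (\- f).
Proof.
move=> /(intgZ (-1)); apply: eq_integrable => // x _ /=.
by rewrite mulN1r.
Qed.

Lemma Rdominated_convergence (f_ : nat -> R -> R) f g :
  (forall n, measurable_fun setT (f_ n)) -> measurable_fun setT f ->
  {ae mu, forall x, f_ n x @[n --> \oo] --> f x} ->
  intg g -> (forall n x, `|f_ n x| <= g x) ->
  \int[mu]_x f_ n x @[n --> \oo] --> \int[mu]_x f x.
Proof.
move=> mf_ mf f_f intgg f_g.
have [| | | | |intf _ fcvg] := @dominated_convergence _ _ _ mu _ measurableT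
    (fun n x => (f_ n x)%:E) (EFin \o f) (EFin \o g).
- by move=> n; apply/measurable_EFinP; exact: mf_.
- exact/measurable_EFinP.
- by apply: ae_mono f_f => x fx _; apply: cvg_EFin => //; exact: nearW.
- exact: intgg.
- by apply: nearW => x n _; rewrite lee_fin; exact: f_g.
apply: fine_cvg; rewrite /Rintegral fineK; first exact: fcvg.
exact: (integrable_fin_num measurableT intf).
Qed.

Lemma measurable_cos : measurable_fun setT (@cos R).
Proof. by apply: continuous_measurable_fun; exact: continuous_cos. Qed.

Lemma measurable_sin : measurable_fun setT (@sin R).
Proof. by apply: continuous_measurable_fun; exact: continuous_sin. Qed.

Lemma measurable_cos_kernel (c s : R) :
  measurable_fun setT (fun z : R * R => cos (c * (z.2 - s) * z.1)).
Proof.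
apply: measurableT_comp measurable_cos _; apply: measurable_funM => //.
by apply: measurable_funM => //; exact: measurable_funB.
Qed.

Lemma measurable_sin_kernel (c s : R) :
  measurable_fun setT (fun z : R * R => sin (c * (z.2 - s) * z.1)).
Proof.
apply: measurableT_comp measurable_sin _; apply: measurable_funM => //.
by apply: measurable_funM => //; exact: measurable_funB.
Qed.

Lemma measurable_cos_scale c : measurable_fun setT (fun x => cos (c * x)).
Proof. by apply: measurableT_comp measurable_cos _; exact: measurable_funM. Qed.

Lemma measurable_sin_scale c : measurable_fun setT (fun x => sin (c * x)).
Proof. by apply: measurableT_comp measurable_sin _; exact: measurable_funM. Qed.

Lemma measurable_cos_lin c s : measurable_fun setT (fun x => cos (c * (x - s))).
Proof.
apply: measurableT_comp measurable_cos _; apply: measurable_funM => //.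
exact: measurable_funB.
Qed.

Lemma measurable_sin_lin c s : measurable_fun setT (fun x => sin (c * (x - s))).
Proof.
apply: measurableT_comp measurable_sin _; apply: measurable_funM => //.
exact: measurable_funB.
Qed.

Lemma intg_mul_cos f c s : intg f -> intg (fun x => f x * cos (c * (x - s))).
Proof.
move=> intf; apply: (@intg_bounded_mul _ _ _ 1) => //.
  exact: measurable_cos_lin.
by move=> x; exact: cos_max.
Qed.

Lemma intg_mul_sin f c s : intg f -> intg (fun x => f x * sin (c * (x - s))).
Proof.
move=> intf; apply: (@intg_bounded_mul _ _ _ 1) => //.
  exact: measurable_sin_lin.
by move=> x; exact: sin_max.
Qed.

Lemma intg_mul_cos0 f c : intg f -> intg (fun x => f x * cos (c * x)).
Proof.
move=> /(intg_mul_cos _ c 0); apply: eq_integrable => // x _ /=.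
by rewrite subr0.
Qed.

Lemma intg_mul_sin0 f c : intg f -> intg (fun x => f x * sin (c * x)).
Proof.
move=> /(intg_mul_sin _ c 0); apply: eq_integrable => // x _ /=.
by rewrite subr0.
Qed.

(** With [u = a +i* b], the Fourier integral of [u] is
    [ctrans a b +i* ctrans b (\- a)]; with [F = A +i* B], the inverse Fourier
    integral of [F] is [ctrans A (\- B) +i* ctrans B A]. *)
Definition ctrans a b w : R :=
  \int[mu]_t (a t * cos (2 * pi * w * t) + b t * sin (2 * pi * w * t)).

Lemma ctransE a b w : intg a -> intg b -> ctrans a b w =
  \int[mu]_t (a t * cos (2 * pi * w * t)) +
  \int[mu]_t (b t * sin (2 * pi * w * t)).
Proof.
move=> inta intb; rewrite /ctrans RintegralTD//.
- exact: intg_mul_cos0.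
- exact: intg_mul_sin0.
Qed.

Lemma intg_cos_kernel f a s : intg f -> intg a ->
  intg (fun w => f w * \int[mu]_t (a t * cos (2 * pi * (t - s) * w))).
Proof.
move=> intf inta.
apply: (@intg_kernel _ _ _ (fun z => cos (2 * pi * (z.2 - s) * z.1)) 1) => //.
- exact: measurable_cos_kernel.
- by move=> z; exact: cos_max.
Qed.

Lemma intg_sin_kernel f a s : intg f -> intg a ->
  intg (fun w => f w * \int[mu]_t (a t * sin (2 * pi * (t - s) * w))).
Proof.
move=> intf inta.
apply: (@intg_kernel _ _ _ (fun z => sin (2 * pi * (z.2 - s) * z.1)) 1) => //.
- exact: measurable_sin_kernel.
- by move=> z; exact: sin_max.
Qed.

Lemma intg_mul_ctrans f a b : intg f -> intg a -> intg b ->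
  intg (fun w => f w * ctrans a b w).
Proof.
move=> intf inta intb.
have := intgD _ _ (intg_cos_kernel f a 0 intf inta) (intg_sin_kernel f b 0 intf intb).
apply: eq_integrable => // w _ /=; congr EFin.
rewrite ctransE// -mulrDr; congr (_ * _).
have E t : 2 * pi * w * t = 2 * pi * (t - 0) * w by ring.
by congr (_ + _); apply: eq_Rintegral => t _; rewrite E.
Qed.

(** Fubini only gives the measurability of [ctrans a b] times an integrable
    weight; an everywhere positive weight can be divided out *)
Lemma measurable_ctrans a b : intg a -> intg b -> measurable_fun setT (ctrans a b).
Proof.
move=> inta intb.
have mexp : measurable_fun setT (fun w : R => expR `|w|).
  by apply: measurableT_comp => //; exact: measurable_expR.
have h := intg_measurable _ (intg_mul_ctrans _ _ _ (intg_abel 1 ltr01) inta intb).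
apply: eq_measurable_fun (measurable_funM mexp h) => w _ /=.
by rewrite mulrA /abel mul1r -expRD subrr expR0 mul1r.
Qed.

Lemma Rintegral_abel_sin e c : 0 < e ->
  \int[mu]_w (abel e w * sin (c * w)) = 0.
Proof.
move=> e0; apply: Rintegral_odd; first exact/intg_mul_sin0/intg_abel.
by move=> w; rewrite /abel normrN mulrN sinN mulrN.
Qed.

(** On the left is the real part of the inverse Fourier integral at [s] of the
    transform of [a +i* b], weighted by [abel e]. Exchanging the integrals leaves
    the transform of [abel e] at [t - s]: its cosine part is the Poisson kernel
    and its sine part, which multiplies [b], vanishes since [abel e] is even. *)
Lemma abel_mean_transform e a b s : 0 < e -> intg a -> intg b ->
  \int[mu]_w (abel e w * (ctrans a b w * cos (2 * pi * s * w) -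
                           ctrans b (\- a) w * sin (2 * pi * s * w))) =
  \int[mu]_t (a t * poisson e (t - s)).
Proof.
move=> e0 inta intb.
have intNa : intg (\- a) by exact: intgN.
transitivity (\int[mu]_w
    (abel e w * \int[mu]_t (a t * cos (2 * pi * (t - s) * w)) +
     abel e w * \int[mu]_t (b t * sin (2 * pi * (t - s) * w)))).
  apply: eq_Rintegral => w _; rewrite -mulrDr; congr (_ * _).
  rewrite /ctrans mulrC [X in _ - X]mulrC -!RintegralTZl//; last 2 first.
    by apply: intgD; [exact: intg_mul_cos0|exact: intg_mul_sin0].
    by apply: intgD; [exact: intg_mul_cos0|exact: intg_mul_sin0].
  rewrite -RintegralTB//; last 2 first.
    by apply/intgZ/intgD; [exact: intg_mul_cos0|exact: intg_mul_sin0].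
    by apply/intgZ/intgD; [exact: intg_mul_cos0|exact: intg_mul_sin0].
  rewrite -RintegralTD//.
  - apply: eq_Rintegral => t _.
    have -> : 2 * pi * (t - s) * w = 2 * pi * w * t - 2 * pi * s * w by ring.
    by rewrite sinB cosB /=; ring.
  - have := intg_mul_cos a (2 * pi * w) s inta; apply: eq_integrable => // t _ /=.
    by rewrite mulrAC.
  - have := intg_mul_sin b (2 * pi * w) s intb; apply: eq_integrable => // t _ /=.
    by rewrite mulrAC.
rewrite RintegralTD; last 2 first.
  by apply: intg_cos_kernel => //; exact: intg_abel.
  by apply: intg_sin_kernel => //; exact: intg_abel.
rewrite (@Rintegral_Fubini _ _ _ (fun z => cos (2 * pi * (z.2 - s) * z.1)) 1)//;
  [|exact: intg_abel|exact: measurable_cos_kernel|by move=> z; exact: cos_max].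
rewrite (@Rintegral_Fubini _ _ _ (fun z => sin (2 * pi * (z.2 - s) * z.1)) 1)//;
  [|exact: intg_abel|exact: measurable_sin_kernel|by move=> z; exact: sin_max].
rewrite /= [X in _ + X](_ : _ = 0) ?addr0; last first.
  transitivity (\int[mu]_(t in setT) (0 : R)); last by rewrite Rintegral_cst// mul0r.
  by apply: eq_Rintegral => t _; rewrite Rintegral_abel_sin// mulr0.
by apply: eq_Rintegral => t _; rewrite Rintegral_abel_cos.
Qed.

End Ctrans.

(** * Abel means of a mean-square spectrum *)

Section Inversion.
Context {R : realType}.
Local Notation mu := (@lebesgue_measure R).
Local Notation intg f := (mu.-integrable setT (EFin \o f)).
Implicit Types (f g h k a b A B p : R -> R) (e c s w t u x r : R).

Lemma intg_oneDsqrV : intg (fun t => (1 + t ^+ 2)^-1).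
Proof.
have eqo : (fun t => (1 + t ^+ 2)^-1) = (fun t => (oneDsqr t)^-1).
  by apply/funext => t; rewrite /oneDsqr.
rewrite eqo; apply: intgP.
- by apply: continuous_measurable_fun; exact: continuous_oneDsqrV.
- by move=> x; rewrite invr_ge0 addr_ge0// sqr_ge0.
- rewrite ge0_symfun_integralT.
  + by rewrite -set_itvcy integral0y_oneDsqr -EFinM ltry.
  + by move=> x; rewrite invr_ge0 addr_ge0// sqr_ge0.
  + exact: continuous_oneDsqrV.
  + by move=> x /=; rewrite /oneDsqr sqrrN.
Qed.

Lemma poisson_den_gt0 e u : 0 < e -> 0 < e ^+ 2 + (2 * pi * u) ^+ 2.
Proof. by move=> e0; rewrite ltr_wpDr ?sqr_ge0// exprn_gt0. Qed.

Lemma poisson_ge0 e u : 0 < e -> 0 <= poisson e u.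
Proof.
move=> e0; rewrite divr_ge0//; first by rewrite mulr_ge0// ltW.
exact/ltW/poisson_den_gt0.
Qed.

Lemma poisson_le e u : 0 < e -> poisson e u <= 2 / e.
Proof.
move=> e0; rewrite ler_pdivrMr; last exact: poisson_den_gt0.
have -> : 2 / e * (e ^+ 2 + (2 * pi * u) ^+ 2) =
   2 * e + 2 / e * (2 * pi * u) ^+ 2 by field; rewrite gt_eqF.
by rewrite lerDl mulr_ge0 ?sqr_ge0// divr_ge0// ltW.
Qed.

(** From [2 pi >= 4] *)
Lemma sqr_poisson_le e u : 0 < e -> u ^+ 2 * poisson e u <= e / 2.
Proof.
move=> e0; rewrite /poisson mulrA ler_pdivrMr; last exact: poisson_den_gt0.
have : (4 * u) ^+ 2 <= (2 * pi * u) ^+ 2.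
  rewrite !exprMn ler_wpM2r ?sqr_ge0// -exprMn lerXn2r ?nnegrE ?mulr_ge0 ?pi_ge0//.
  by have := @pi_ge2 R; lra.
set D := (2 * pi * u) ^+ 2 => h; have := sqr_ge0 e; have := sqr_ge0 u; nra.
Qed.

(** From [1 + t ^ 2 <= 1 + 2 r ^ 2 + 2 (t - s) ^ 2] and [sqr_poisson_le]: a
    decay in [t] that is uniform for [s] in a bounded set *)
Lemma poisson_decay e r t s : 0 < e -> `|s| <= r ->
  (1 + t ^+ 2) * poisson e (t - s) <= (1 + 2 * r ^+ 2) * poisson e (t - s) + e.
Proof.
move=> e0 sr; have P0 := poisson_ge0 e (t - s) e0.
have uP := sqr_poisson_le e (t - s) e0.
have r0 : 0 <= r by exact: le_trans sr.
have s2 : s ^+ 2 <= r ^+ 2.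
  by rewrite -(real_normK (num_real s)) lerXn2r// nnegrE.
have t2 : 1 + t ^+ 2 <= 1 + 2 * r ^+ 2 + 2 * (t - s) ^+ 2.
  have : 0 <= (t - 2 * s) ^+ 2 by exact: sqr_ge0.
  lra.
apply: le_trans (ler_wpM2r P0 t2) _.
by move: uP; set U := (t - s) ^+ 2; set P := poisson _ _; lra.
Qed.

Lemma continuous_poisson e s : 0 < e -> continuous (fun t => poisson e (t - s)).
Proof.
move=> e0 t; apply: cvgM; first exact: cvg_cst.
apply: cvgV; first by rewrite gt_eqF// poisson_den_gt0.
apply: cvgD; first exact: cvg_cst.
apply: (@cvg_comp _ _ _ (fun t => 2 * pi * (t - s)) (fun x : R => x ^+ 2)); last exact: exprn_continuous.
apply: cvgM; first exact: cvg_cst.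
by apply: cvgB; [exact: cvg_id|exact: cvg_cst].
Qed.

Lemma intg_poisson e s : 0 < e -> intg (fun t => poisson e (t - s)).
Proof.
move=> e0; pose C := (1 + 2 * s ^+ 2) * (2 / e) + e.
apply: (@le_intg _ _ (fun t => C * (1 + t ^+ 2)^-1)).
- by apply: continuous_measurable_fun; exact: continuous_poisson.
- move=> t; rewrite ger0_norm ?poisson_ge0//.
  rewrite ler_pdivlMr; last by rewrite ltr_wpDr ?sqr_ge0.
  rewrite mulrC; apply: le_trans (poisson_decay e `|s| t s e0 (lexx _)) _.
  rewrite lerD2r real_normK ?num_real// ler_wpM2l ?poisson_le//.
  by rewrite addr_ge0// mulr_ge0// sqr_ge0.
- exact/intgZ/intg_oneDsqrV.
Qed.

(** [p] is the real part of a function with spectrum [A +i* B]. Only the real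
    part of the function is mentioned, because the identity on Abel means
    involves nothing else; the imaginary part of a function [f] is the real part
    of [- 'i * f]. *)
Definition L2_spectrum p A B : Prop :=
  [/\ [/\ measurable_fun setT p, measurable_fun setT A & measurable_fun setT B],
      [/\ intg (fun t => p t ^+ 2), intg (fun w => A w ^+ 2) &
          intg (fun w => B w ^+ 2)] &
      exists a_ b_ : nat -> R -> R,
      [/\ forall n, intg (a_ n) /\ intg (b_ n),
          (\int[mu]_t ((a_ n t - p t) ^+ 2)%:E)%E @[n --> \oo] --> 0%E,
          (\int[mu]_w ((ctrans (a_ n) (b_ n) w - A w) ^+ 2)%:E)%E
             @[n --> \oo] --> 0%E &
          (\int[mu]_w ((ctrans (b_ n) (\- a_ n) w - B w) ^+ 2)%:E)%E
             @[n --> \oo] --> 0%E]].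

(** The weights [abel e w * cos _], [abel e w * sin _] and [poisson e (t - s)]
    are square-integrable, so that both sides of [abel_mean_transform] converge *)
Lemma abel_mean_spectrum e p A B s : 0 < e -> L2_spectrum p A B ->
  \int[mu]_w (A w * (abel e w * cos (2 * pi * s * w))) -
  \int[mu]_w (B w * (abel e w * sin (2 * pi * s * w))) =
  \int[mu]_t (p t * poisson e (t - s)).
Proof.
move=> e0 [[mp mA mB] [p2 A2 B2] [a_ [b_ [iab ap aA bB]]]].
have ic : intg (fun w => abel e w * cos (2 * pi * s * w)).
  exact/intg_mul_cos0/intg_abel.
have isn : intg (fun w => abel e w * sin (2 * pi * s * w)).
  exact/intg_mul_sin0/intg_abel.
have ic2 : intg (fun w => (abel e w * cos (2 * pi * s * w)) ^+ 2).
  apply: (intg_sq_bounded _ 1) => // w; rewrite normrM mulr_ile1 ?cos_max//.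
  by rewrite normr_abel_le1// ltW.
have is2 : intg (fun w => (abel e w * sin (2 * pi * s * w)) ^+ 2).
  apply: (intg_sq_bounded _ 1) => // w; rewrite normrM mulr_ile1 ?sin_max//.
  by rewrite normr_abel_le1// ltW.
have ip2 : intg (fun t => poisson e (t - s) ^+ 2).
  apply: (intg_sq_bounded _ (2 / e)); first exact: intg_poisson.
  by move=> t; rewrite ger0_norm ?poisson_ge0// poisson_le.
have mct n : measurable_fun setT (ctrans (a_ n) (b_ n)).
  by have [] := iab n; exact: measurable_ctrans.
have mct' n : measurable_fun setT (ctrans (b_ n) (\- a_ n)).
  by have [? ?] := iab n; apply: measurable_ctrans => //; exact: intgN.
have L1 := cvg_L2_pairing _ _ _ mct mA (intg_measurable _ ic) A2 ic2 aA.
have L2 := cvg_L2_pairing _ _ _ mct' mB (intg_measurable _ isn) B2 is2 bB.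
have L3 := cvg_L2_pairing _ _ _ (fun n => intg_measurable _ (iab n).1) mp
  (intg_measurable _ (intg_poisson e s e0)) p2 ip2 ap.
apply: (cvg_unique _ (cvgB L1 L2)) => //.
apply: cvg_trans L3; apply: near_eq_cvg; apply: nearW => n /=.
have [ia ib] := iab n.
rewrite -(abel_mean_transform e (a_ n) (b_ n) s)// !fctE -RintegralTB.
- by apply: eq_Rintegral => w _; ring.
- have := intg_mul_cos0 _ (2 * pi * s) (intg_mul_ctrans _ _ _ (intg_abel e e0) ia ib).
  by apply: eq_integrable => // w _ /=; congr EFin; ring.
- have := intg_mul_sin0 _ (2 * pi * s) (intg_mul_ctrans _ _ _ (intg_abel e e0) ib (intgN _ ia)).
  by apply: eq_integrable => // w _ /=; congr EFin; ring.
Qed.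

End Inversion.

(** * Integrals of the inverse transform over segments *)

Section Averages.
Context {R : realType}.
Local Notation mu := (@lebesgue_measure R).
Local Notation intg f := (mu.-integrable setT (EFin \o f)).
Implicit Types (f g h k A B p : R -> R) (e c s w t u x r a b : R).

Lemma Rintegral_indic (D : set R) f :
  \int[mu]_x (\1_D x * f x) = \int[mu]_(x in D) f x.
Proof.
rewrite [RHS]Rintegral_mkcond; apply: eq_Rintegral => x _.
by rewrite patchE indicE; case: ifP => _; rewrite (mul1r, mul0r).
Qed.

Lemma normr_indic_le1 (D : set R) x : `|(\1_D x : R)| <= 1.
Proof. by rewrite indicE; case: (x \in D); rewrite ?normr1 ?normr0. Qed.

Lemma intg_indic_itv a b : intg (\1_(`[a, b]%classic : set R)).
Proof. exact: (@integrable_indic_itv R a b true false). Qed.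

Lemma measurable_indic_itv a b :
  measurable_fun setT (\1_(`[a, b]%classic : set R) : R -> R).
Proof. by apply: intg_measurable; exact: intg_indic_itv. Qed.

Lemma integral_poisson e a b t : 0 < e -> a < b ->
  \int[mu]_(s in `[a, b]) poisson e (t - s) =
  (atan (2 * pi * (b - t) / e) - atan (2 * pi * (a - t) / e)) / pi.
Proof.
move=> e0 ab.
pose F s : R := pi^-1 * atan (2 * pi * (s - t) / e).
have pi0 : (pi : R) != 0 by rewrite gt_eqF// pi_gt0.
have dF s : is_derive s (1 : R) F (poisson e (t - s)).
  have dlin : is_derive s (1 : R) (fun s => 2 * pi / e * s - 2 * pi / e * t) (2 * pi / e).
    have := is_deriveB (is_derive_scale (2 * pi / e) s)
      (is_derive_cst (2 * pi / e * t) s 1).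
    by rewrite subr0.
  have := @is_derive1_comp R atan _ s _ _ (is_derive1_atan _) dlin.
  move=> h; have := is_derive_mull pi^-1 _ _ s h.
  have -> : (fun y : R => pi^-1 *
      (atan \o (fun s => 2 * pi / e * s - 2 * pi / e * t)) y) = F.
    apply/funext => x; rewrite /F /=; congr (_ * atan _).
    by field; rewrite gt_eqF.
  move=> hF; apply: (is_derive_eq hF).
  have D0 := poisson_den_gt0 e (t - s) e0.
  have D1 : 1 + (2 * pi / e * s - 2 * pi / e * t) ^+ 2 != 0.
    by rewrite gt_eqF// ltr_wpDr ?sqr_ge0.
  have D2 : 1 + (2 * pi / e * s - 2 * pi / e * t) ^+ 2 =
    (e ^+ 2 + (2 * pi * (t - s)) ^+ 2) / e ^+ 2 by field; rewrite gt_eqF.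
  rewrite D2 /poisson; move: (pi : R) pi0 D0 => q q0 D0; field.
  by rewrite q0 !gt_eqF.
have cF s : {for s, continuous F}.
  by apply/differentiable_continuous/derivable1_diffP; have [] := dF s.
rewrite /Rintegral (@continuous_FTC2 _ _ F)//.
- by rewrite /F/= -mulrBr mulrC.
- apply: continuous_subspaceT => x.
  rewrite (_ : (fun _ => _) = (fun s => poisson e (s - t))); last first.
    by apply/funext => s; exact: poissonC.
  exact: continuous_poisson.
- split.
  + by move=> x _; have [] := dF x.
  + by apply: cvg_at_right_filter; exact: cF.
  + by apply: cvg_at_left_filter; exact: cF.
- by move=> x _; rewrite derive1E; have [] := dF x.
Qed.

Lemma cvg_atan_scale c : c != 0 ->
  atan (c * n.+1%:R) @[n --> \oo] --> (Num.sg c * (pi / 2) : R).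
Proof.
have pos d : 0 < d -> atan (d * n.+1%:R) @[n --> \oo] --> (pi / 2 : R).
  move=> d0; apply: (@cvg_comp _ _ _ (fun n => d * n.+1%:R) atan _ +oo _ _ (@cvgy_atan R)).
  apply: (@cvg_comp _ _ _ (fun n => n.+1%:R : R) (fun r => d * r) _ +oo).
    by have := @cvgr_idn R; rewrite -cvg_shiftS.
  by apply: gt0_cvgMry => //; exact: cvg_id.
case: (ltgtP c 0) => // c0 _; last by rewrite gtr0_sg// mul1r; exact: pos.
rewrite ltr0_sg// mulN1r.
have -> : (fun n => atan (c * n.+1%:R)) = (fun n => - atan (- c * n.+1%:R)).
  by apply/funext => n; rewrite mulNr atanN opprK.
by apply: cvgN; apply: pos; rewrite oppr_gt0.
Qed.

Lemma cvg_integral_poisson a b t : a < b -> t != a -> t != b ->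
  \int[mu]_(s in `[a, b]) poisson n.+1%:R^-1 (t - s) @[n --> \oo] -->
  (\1_(`[a, b]%classic : set R) t : R).
Proof.
move=> ab ta tb.
have pi0 : (0 : R) < pi by exact: pi_gt0.
have lim c : c != 0 -> atan (2 * pi * c / n.+1%:R^-1) @[n --> \oo] -->
    (Num.sg c * (pi / 2) : R).
  move=> c0; under eq_fun do rewrite invrK.
  have -> : Num.sg c = Num.sg (2 * pi * c).
    by rewrite sgrM (gtr0_sg (_ : 0 < 2 * pi)) ?mul1r// mulr_gt0.
  by apply: cvg_atan_scale; rewrite !mulf_neq0// gt_eqF.
have -> : (\1_(`[a, b]%classic : set R) t : R) =
   (Num.sg (b - t) * (pi / 2) - Num.sg (a - t) * (pi / 2)) / pi.
  rewrite indicE; have [tin|tout] := boolP (t \in _).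
    move: tin; rewrite inE/= in_itv/= => /andP[].
    rewrite !le_eqVlt (negbTE tb) eq_sym (negbTE ta)/= => at_ tb_.
    rewrite gtr0_sg ?subr_gt0// ltr0_sg ?subr_lt0//.
    by move: (pi : R) pi0 => q q0; field; rewrite gt_eqF.
  move: tout; rewrite notin_setE/= in_itv/= => /negP; rewrite negb_and -!ltNge.
  move=> /orP[h|h].
    rewrite (gtr0_sg (_ : 0 < b - t)) ?subr_gt0 ?(lt_trans h)//.
    by rewrite (gtr0_sg (_ : 0 < a - t)) ?subr_gt0// subrr mul0r.
  rewrite (ltr0_sg (_ : b - t < 0)) ?subr_lt0//.
  by rewrite (ltr0_sg (_ : a - t < 0)) ?subr_lt0 ?(lt_trans _ h)// subrr mul0r.
have E n : \int[mu]_(s in `[a, b]) poisson n.+1%:R^-1 (t - s) =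
  (atan (2 * pi * (b - t) / n.+1%:R^-1) - atan (2 * pi * (a - t) / n.+1%:R^-1)) / pi.
  by rewrite integral_poisson// invr_gt0.
under eq_fun do rewrite E.
apply: cvgM; last exact: cvg_cst.
by apply: cvgB; apply: lim; rewrite subr_eq0 eq_sym.
Qed.

Lemma integral_poisson_le1 e a b t : 0 < e -> a < b ->
  \int[mu]_(s in `[a, b]) poisson e (t - s) <= 1.
Proof.
move=> e0 ab; rewrite integral_poisson// ler_pdivrMr ?pi_gt0// mul1r.
have := atan_ltpi2 (2 * pi * (b - t) / e).
have := atan_gtNpi2 (2 * pi * (a - t) / e).
lra.
Qed.

Lemma intg_itv_poisson e a b t : 0 < e ->
  mu.-integrable `[a, b] (EFin \o (fun s => poisson e (t - s))).
Proof.
move=> e0; apply: (integrableS measurableT) => //.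
have := intg_poisson e t e0; apply: eq_integrable => // s _ /=.
by rewrite poissonC.
Qed.

(** The bound does not depend on [e], so that it serves as a dominating function
    when [e] tends to 0 *)
Lemma integral_poisson_decay e a b t : 0 < e -> e <= 1 -> a < b ->
  \int[mu]_(s in `[a, b]) poisson e (t - s) <=
  (1 + 2 * (`|a| + `|b|) ^+ 2 + (b - a)) * (1 + t ^+ 2)^-1.
Proof.
move=> e0 e1 ab; set r := `|a| + `|b|.
rewrite ler_pdivlMr; last by rewrite ltr_wpDr ?sqr_ge0.
rewrite mulrC.
have ip := intg_itv_poisson e a b t e0.
have mu1 : mu.-integrable `[a, b] (EFin \o (fun _ : R => e)).
  apply: measurable_bounded_integrable => //=.
    by rewrite lebesgue_measure_itv/= lte_fin ab -EFinB ltry.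
  exact: bounded_cst.
have ipc c : mu.-integrable `[a, b] (EFin \o (fun s => c * poisson e (t - s))).
  have := @integrableZl _ _ _ mu `[a, b]%classic _ c _ ip; exact.
rewrite -RintegralZl//.
apply: (@le_trans _ _ (\int[mu]_(s in `[a, b])
   ((1 + 2 * r ^+ 2) * poisson e (t - s) + e))).
  apply: le_Rintegral => //.
    have := @integrableD _ _ _ mu `[a, b]%classic _ _ _ (ipc _) mu1; exact.
  move=> s /=; rewrite in_itv/= => /andP[as_ sb].
  apply: poisson_decay => //.
  rewrite ler_norml; have := ler_norm b; have := ler_norm (- a).
  have := normr_ge0 a; have := normr_ge0 b; rewrite normrN /r.
  by move=> *; apply/andP; split; lra.
rewrite (RintegralD _ (ipc _) mu1)//.
rewrite (RintegralZl _ _ ip)// Rintegral_cst//=.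
rewrite lebesgue_measure_itv/= lte_fin ab/=.
have := integral_poisson_le1 e a b t e0 ab; set I := Rintegral _ _ _ => I1.
have r2 : 0 <= 1 + 2 * r ^+ 2 by rewrite addr_ge0// mulr_ge0// sqr_ge0.
have ba : 0 <= b - a by rewrite subr_ge0 ltW.
rewrite lerD//; first by rewrite ler_piMr.
by rewrite ler_piMl.
Qed.


(** Abel summation recovers the inverse transform of an integrable spectrum *)
Lemma cvg_abel_mean A B s : intg A -> intg B ->
  \int[mu]_w (A w * (abel n.+1%:R^-1 w * cos (2 * pi * s * w))) -
  \int[mu]_w (B w * (abel n.+1%:R^-1 w * sin (2 * pi * s * w)))
    @[n --> \oo] --> ctrans A (\- B) s.
Proof.
move=> intA intB.
have abel1 w : abel n.+1%:R^-1 w @[n --> \oo] --> (1 : R).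
  rewrite -[X in _ --> X](@expR0 R); apply: (@cvg_comp _ _ _
      (fun n : nat => - (n.+1%:R^-1 * `|w|)) expR _ (nbhs (0 : R))).
    have h : (n.+1%:R^-1 * `|w|) @[n --> \oo] --> (0 : R).
      by rewrite -[X in _ --> X](mul0r `|w|); apply: cvgMl; exact: cvg_harmonic.
    by rewrite -oppr0; exact: (cvgN h).
  exact: continuous_expR.
have tcvg f (K : R -> R) : intg f -> measurable_fun setT K ->
    (forall w, `|K w| <= 1) ->
    \int[mu]_w (f w * (abel n.+1%:R^-1 w * K w)) @[n --> \oo] -->
    \int[mu]_w (f w * K w).
  move=> intf mK K1; have mf := intg_measurable _ intf.
  apply: (@Rdominated_convergence _ _ _ (fun w => `|f w|)).
  - move=> n; apply: measurable_funM => //; apply: measurable_funM => //.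
    exact: measurable_abel.
  - exact: measurable_funM.
  - apply: nearW => w; apply: cvgMr; rewrite -[X in _ --> X]mul1r.
    by apply: cvgMl; exact: abel1.
  - exact: integrable_norm.
  - move=> n w; rewrite normrM ler_piMr// normrM mulr_ile1//.
    exact: normr_abel_le1.
have mcos := measurable_cos_scale (2 * pi * s).
have msin := measurable_sin_scale (2 * pi * s).
rewrite ctransE//; last exact: intgN.
have -> : \int[mu]_t ((\- B) t * sin (2 * pi * s * t)) =
    - \int[mu]_t (B t * sin (2 * pi * s * t)).
  rewrite -mulN1r -RintegralTZl; last exact: intg_mul_sin0.
  by apply: eq_Rintegral => t _ /=; rewrite mulN1r mulNr.
apply: cvgB; apply: tcvg => // w; [exact: cos_max|exact: sin_max].
Qed.

(** Integrate [abel_mean_spectrum] over [`[a, b]] with [e = 1 / (n + 1)] and let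
    [n] tend to infinity on both sides ([stepA] and [stepC]); in between,
    [stepB] exchanges the integrals in [s] and [t] on the Poisson side. *)
Lemma Rintegral_inverse_transform p A B a b : a < b -> L2_spectrum p A B ->
  intg A -> intg B ->
  \int[mu]_(s in `[a, b]) ctrans A (\- B) s = \int[mu]_(t in `[a, b]) p t.
Proof.
move=> ab spec intA intB.
have [[mp mA mB] [p2 A2 B2] _] := spec.
set I : set R := `[a, b]%classic.
pose e (n : nat) : R := n.+1%:R^-1.
have e0 n : 0 < e n by rewrite invr_gt0.
have e1 n : e n <= 1 by rewrite invf_le1// ler1n.
pose X n s := \int[mu]_w (A w * (abel (e n) w * cos (2 * pi * s * w))) -
  \int[mu]_w (B w * (abel (e n) w * sin (2 * pi * s * w))).
pose M n t := \int[mu]_(s in `[a, b]) poisson (e n) (t - s).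
have intf_abel f n : intg f -> intg (fun w => f w * abel (e n) w).
  move=> intf; apply: (@intg_bounded_mul _ _ _ 1) => //; first exact: measurable_abel.
  by move=> w; exact/normr_abel_le1/ltW.
have stepA : \int[mu]_s (\1_I s * X n s) @[n --> \oo] -->
    \int[mu]_s (\1_I s * ctrans A (\- B) s).
  pose C := \int[mu]_w `|A w| + \int[mu]_w `|B w|.
  apply: (@Rdominated_convergence _ _ _ (fun s => C * \1_I s)).
  - move=> n; apply: measurable_funM; first exact: measurable_indic_itv.
    have := measurable_ctrans _ _ (intf_abel _ n intA) (intgN _ (intf_abel _ n intB)).
    apply: eq_measurable_fun => s _; rewrite ctransE; last 2 first.
      exact: intf_abel.
      exact/intgN/intf_abel.
    rewrite /X; congr (_ + _); first by apply: eq_Rintegral => w _; rewrite mulrA.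
    rewrite -mulN1r -RintegralTZl.
      by apply: eq_Rintegral => w _ /=; ring.
    have := intg_mul_sin0 _ (2 * pi * s) (intf_abel _ n intB).
    by apply: eq_integrable => // w _ /=; rewrite mulrA.
  - apply: measurable_funM; first exact: measurable_indic_itv.
    by apply: measurable_ctrans => //; exact: intgN.
  - by apply: nearW => s; apply: cvgMr; exact: cvg_abel_mean.
  - exact/intgZ/intg_indic_itv.
  - move=> n s; rewrite normrM [leRHS]mulrC ger0_norm ?indicE// ler_wpM2l//.
    rewrite (le_trans (ler_normB _ _))//.
    have bnd f (K : R -> R) : intg f -> measurable_fun setT K ->
        (forall w, `|K w| <= 1) ->
        `|\int[mu]_w (f w * (abel (e n) w * K w))| <= \int[mu]_w `|f w|.
      move=> intf mK K1.
      have iK : intg (fun w => f w * (abel (e n) w * K w)).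
        apply: (@intg_bounded_mul _ _ _ 1) => //.
          by apply: measurable_funM => //; exact: measurable_abel.
        by move=> w; rewrite normrM mulr_ile1//; exact/normr_abel_le1/ltW.
      apply: le_trans (le_normr_Rintegral measurableT iK) _.
      apply: le_Rintegral => //; [exact: integrable_norm..|].
      move=> w _; rewrite normrM ler_piMr// normrM mulr_ile1//.
      exact/normr_abel_le1/ltW.
    rewrite lerD//; apply: bnd => //.
    + exact: measurable_cos_scale.
    + by move=> w; exact: cos_max.
    + exact: measurable_sin_scale.
    + by move=> w; exact: sin_max.
have iq : intg (fun t => p t * (1 + t ^+ 2)^-1).
  apply: intg_mul => //; first exact: intg_measurable intg_oneDsqrV.
  apply: (intg_sq_bounded _ 1); first exact: intg_oneDsqrV.
  move=> t; rewrite ger0_norm ?invr_ge0 ?addr_ge0 ?sqr_ge0//.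
  by rewrite invf_le1 ?lerDl ?sqr_ge0// ltr_wpDr ?sqr_ge0.
(* [p] itself need not be integrable, so Fubini is applied to [p t / (1 + t ^ 2)],
   the decay of the Poisson kernel compensating for the factor. The indicator is
   repeated inside [kappa] because this decay is uniform only for [s] in [I]. *)
have stepB n : \int[mu]_s (\1_I s * X n s) = \int[mu]_t (p t * M n t).
  pose kappa (z : R * R) := \1_I z.1 * ((1 + z.2 ^+ 2) * poisson (e n) (z.2 - z.1)).
  pose C := (1 + 2 * (`|a| + `|b|) ^+ 2) * (2 / e n) + e n.
  have C0 : 0 <= C.
    apply: addr_ge0; last exact: ltW.
    apply: mulr_ge0; last by rewrite divr_ge0// ltW.
    by rewrite addr_ge0// mulr_ge0// sqr_ge0.
  have mk : measurable_fun setT kappa.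
    apply: measurable_funM.
      by apply: measurableT_comp => //; exact: measurable_indic_itv.
    apply: measurable_funM.
      by apply: measurable_funD => //; exact: measurable_funX.
    have mpo : measurable_fun setT (poisson (e n)).
      apply: continuous_measurable_fun => t.
      have := continuous_poisson (e n) 0 (e0 n) t.
      by rewrite (_ : (fun t => poisson (e n) (t - 0)) = poisson (e n))//;
        apply/funext => u; rewrite subr0.
    by apply: measurableT_comp mpo _; exact: measurable_funB.
  have kC z : `|kappa z| <= C.
    rewrite /kappa indicE; have [|_] := boolP (z.1 \in I); last by rewrite mul0r normr0.
    rewrite inE /I/= in_itv/= => /andP[az zb]; rewrite mul1r ger0_norm; last first.
      by rewrite mulr_ge0 ?poisson_ge0 ?addr_ge0 ?sqr_ge0.
    have zr : `|z.1| <= `|a| + `|b|.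
      rewrite ler_norml; have := ler_norm b; have := ler_norm (- a).
      have := normr_ge0 a; have := normr_ge0 b; rewrite normrN.
      by move=> *; apply/andP; split; lra.
    apply: le_trans (poisson_decay _ _ z.2 z.1 (e0 n) zr) _.
    rewrite lerD2r; apply: ler_wpM2l; last exact: poisson_le.
    by rewrite addr_ge0// mulr_ge0// sqr_ge0.
  have D1 t : 1 + t ^+ 2 != 0 by rewrite gt_eqF// ltr_wpDr ?sqr_ge0.
  transitivity (\int[mu]_s (\1_I s * \int[mu]_t (p t * (1 + t ^+ 2)^-1 * kappa (s, t)))).
    apply: eq_Rintegral => s _; rewrite indicE.
    have [sI|_] := boolP (s \in I); last by rewrite !mul0r.
    congr (_ * _); rewrite /X (abel_mean_spectrum _ p)//.
    apply: eq_Rintegral => t _; rewrite /kappa/= indicE sI mul1r mulrA.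
    by rewrite mulfVK.
  rewrite (Rintegral_Fubini _ _ kappa C (intg_indic_itv a b) iq mk kC).
  apply: eq_Rintegral => t _; rewrite -mulrA; congr (_ * _).
  rewrite /M -[RHS]Rintegral_indic.
  have iP : intg (fun s => \1_I s * poisson (e n) (t - s)).
    have iPt : intg (fun s => poisson (e n) (t - s)).
      have := intg_poisson (e n) t (e0 n); apply: eq_integrable => // s _ /=.
      by rewrite poissonC.
    have := intg_bounded_mul _ _ 1 iPt (measurable_indic_itv a b) (normr_indic_le1 _).
    by apply: eq_integrable => // s _ /=; rewrite mulrC.
  rewrite -RintegralTZl.
    apply: eq_Rintegral => s _; rewrite /kappa/= indicE.
    case: (s \in I); rewrite ?mul0r ?mulr0// !mul1r mulrA mulVf ?mul1r//.
  have := intgZ (1 + t ^+ 2) _ iP; apply: eq_integrable => // s _ /=.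
  rewrite /kappa/= indicE.
  by case: (s \in I); rewrite ?mul0r ?mulr0// !mul1r.
have mM n : measurable_fun setT (M n).
  have matan : measurable_fun setT (@atan R).
    by apply: continuous_measurable_fun; exact: continuous_atan.
  have mlin c : measurable_fun setT (fun t => atan (2 * pi * (c - t) / e n)).
    apply: measurableT_comp matan _; apply: measurable_funM => //.
    by apply: measurable_funM => //; exact: measurable_funB.
  have := measurable_funM (measurable_funB (mlin b) (mlin a)) (measurable_cst (pi^-1 : R)).
  by apply: eq_measurable_fun => t _; rewrite /M integral_poisson.
have stepC : \int[mu]_t (p t * M n t) @[n --> \oo] --> \int[mu]_t (p t * \1_I t).
  pose C := 1 + 2 * (`|a| + `|b|) ^+ 2 + (b - a).
  apply: (@Rdominated_convergence _ _ _ (fun t => C * `|p t * (1 + t ^+ 2)^-1|)).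
  - by move=> n; exact: measurable_funM.
  - by apply: measurable_funM => //; exact: measurable_indic_itv.
  - have neg x0 : {ae mu, forall t, t != x0}.
      exists [set x0]; split => //; first by rewrite lebesgue_measure_set1.
      by move=> x /= /negP; rewrite negbK => /eqP.
    apply: ae_mono (ae_and _ _ (neg a) (neg b)) => t [ta tb]; apply: cvgMr; exact: cvg_integral_poisson.
  - exact: (intgZ C _ (integrable_norm iq)).
  - move=> n t; rewrite !normrM mulrCA ler_wpM2l//.
    have D0 : 0 <= (1 + t ^+ 2)^-1 by rewrite invr_ge0 addr_ge0// sqr_ge0.
    rewrite (ger0_norm D0) ger0_norm; first exact: integral_poisson_decay.
    by apply: Rintegral_ge0 => s _; exact: poisson_ge0.
rewrite -Rintegral_indic -[RHS]Rintegral_indic.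
have -> : \int[mu]_x (\1_I x * p x) = \int[mu]_t (p t * \1_I t).
  by apply: eq_Rintegral => x _; rewrite mulrC.
apply: (cvg_unique _ stepA) => //.
by apply: cvg_trans stepC; apply: near_eq_cvg; apply: nearW => n; rewrite stepB.
Qed.

End Averages.

(** * Fourier inversion for an integrable spectrum *)

Section Pointwise.
Context {R : realType}.
Local Notation mu := (@lebesgue_measure R).
Local Notation intg f := (mu.-integrable setT (EFin \o f)).
Implicit Types (f g h k A B p : R -> R) (e c s w t u x r a b : R).

(** The primitive of [f] from [a] vanishes on the interval; by Lebesgue's
    theorem its derivative is [f] almost everywhere *)
Lemma ae_zero_of_integrals f a b : intg f ->
  (forall x, x \in `]a, b[ -> \int[mu]_(t in `[a, x]) f t = 0) ->
  {ae mu, forall x, x \in `]a, b[ -> f x = 0}.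
Proof.
move=> intf f0.
have intfy y : mu.-integrable [set` Interval (BLeft a) (BRight y)] (EFin \o f).
  exact: (integrableS measurableT).
have locf := open_integrable_locally openT intf.
apply: ae_mono (FTC1 intfy locf) => x Fx xab; have [|_ <-] := Fx.
  by move: xab; rewrite in_itv/= lte_fin => /andP[].
rewrite derive1E.
rewrite -[RHS](derive_cst (0 : R) (1 : R) x).
apply: near_eq_derive; near=> y; rewrite f0//.
near: y; exact: near_in_itvoo.
Unshelve. all: by end_near. Qed.

Lemma spectrum_inversion p A B a b : L2_spectrum p A B ->
  intg A -> intg B ->
  {ae mu, forall t, t \in `]a, b[ -> p t = ctrans A (\- B) t}.
Proof.
move=> spec intA intB.
have [[mp mA mB] [p2 A2 B2] _] := spec.
pose I : set R := `[a, b]%classic.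
have intI : intg (\1_I) by exact: intg_indic_itv.
have ip : intg (fun t => \1_I t * p t).
  apply: intg_mul => //; first exact: intg_measurable.
  by apply: (intg_sq_bounded _ 1) => // t; exact: normr_indic_le1.
have ic : intg (fun t => \1_I t * ctrans A (\- B) t).
  by apply: intg_mul_ctrans => //; exact: intgN.
have := ae_zero_of_integrals _ a b (intgB _ _ ip ic).
have h x : x \in `]a, b[ -> \int[mu]_(t in `[a, x])
    (\1_I t * p t - \1_I t * ctrans A (\- B) t) = 0.
  rewrite in_itv/= => /andP[ax xb].
  rewrite RintegralB//; [|exact: (integrableS measurableT)..].
  have E g : \int[mu]_(t in `[a, x]) (\1_I t * g t) = \int[mu]_(t in `[a, x]) g t.
    apply: eq_Rintegral => t; rewrite inE/= in_itv/= => /andP[at_ tx].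
    rewrite indicE mem_set ?mul1r// /I/= in_itv/= at_ (le_trans tx)//.
    exact: ltW.
  by rewrite !E (Rintegral_inverse_transform p A B)// subrr.
move=> /(_ h); apply: ae_mono => t /= tE tab; have := tE tab; rewrite indicE mem_set ?mul1r.
  by move=> /eqP; rewrite subr_eq0 => /eqP.
by apply: subset_itv_oo_cc; rewrite /= tab.
Qed.

End Pointwise.

(** * The energy as a quadratic form in the spectrum *)

Section Energy.
Context {R : realType}.
Local Notation mu := (@lebesgue_measure R).
Local Notation intg f := (mu.-integrable setT (EFin \o f)).
Implicit Types (f g h k A B C D p : R -> R) (e c s w t u x r a b : R).

Lemma intg_kernel_swap f g (kappa : R * R -> R) (M : R) : intg f -> intg g ->
  measurable_fun setT kappa -> (forall z, `|kappa z| <= M) ->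
  intg (fun y => g y * \int[mu]_x (f x * kappa (x, y))).
Proof.
move=> intf intgg mk kM.
apply: (@intg_kernel _ g f (fun z => kappa (z.2, z.1)) M) => //.
by apply: measurableT_comp mk _; exact: measurable_fun_pair.
Qed.

(** The pairing, with weight [f], of two integral transforms as a double
    integral: Fubini in [w] and then, for each [w], in [v] *)
Lemma kernel_form f g h (kappa1 kappa2 : R * R -> R) :
  intg f -> intg g -> intg h ->
  measurable_fun setT kappa1 -> measurable_fun setT kappa2 ->
  (forall z, `|kappa1 z| <= 1) -> (forall z, `|kappa2 z| <= 1) ->
  [/\ \int[mu]_t (f t * (\int[mu]_v (h v * kappa2 (t, v))) *
                        \int[mu]_w (g w * kappa1 (t, w))) =
      \int[mu]_w (g w * \int[mu]_v (h v *
         \int[mu]_t (f t * kappa1 (t, w) * kappa2 (t, v)))),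
      intg (fun w => g w * \int[mu]_v (h v *
         \int[mu]_t (f t * kappa1 (t, w) * kappa2 (t, v)))) &
      forall w, intg (fun v => h v *
         \int[mu]_t (f t * kappa1 (t, w) * kappa2 (t, v)))].
Proof.
move=> intf intgg inth mk1 mk2 k1 k2.
pose phi t := f t * \int[mu]_v (h v * kappa2 (t, v)).
have intphi : intg phi by exact: (intg_kernel f h kappa2 1).
have intfk w : intg (fun t => f t * kappa1 (t, w)).
  apply: (@intg_bounded_mul _ _ _ 1) => //.
  by apply: measurableT_comp mk1 _; exact: measurable_pair2.
have E w : \int[mu]_t (phi t * kappa1 (t, w)) =
    \int[mu]_v (h v * \int[mu]_t (f t * kappa1 (t, w) * kappa2 (t, v))).
  rewrite -(Rintegral_Fubini _ h kappa2 1 (intfk w) inth mk2 k2).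
  by apply: eq_Rintegral => t _; rewrite /phi mulrAC.
split.
- rewrite (Rintegral_Fubini phi g kappa1 1 intphi intgg mk1 k1).
  by apply: eq_Rintegral => w _; rewrite E.
- have := intg_kernel_swap phi g kappa1 1 intphi intgg mk1 k1.
  by apply: eq_integrable => // w _ /=; rewrite E.
- by move=> w; exact: intg_kernel_swap.
Qed.

Let cosk (z : R * R) : R := cos (2 * pi * z.1 * z.2).
Let sink (z : R * R) : R := sin (2 * pi * z.1 * z.2).

Let mcosk : measurable_fun setT cosk.
Proof.
apply: measurableT_comp measurable_cos _; apply: measurable_funM => //.
exact: measurable_funM.
Qed.

Let msink : measurable_fun setT sink.
Proof.
apply: measurableT_comp measurable_sin _; apply: measurable_funM => //.
exact: measurable_funM.
Qed.

Let cosk1 z : `|cosk z| <= 1. Proof. exact: cos_max. Qed.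
Let sink1 z : `|sink z| <= 1. Proof. exact: sin_max. Qed.

Let ct A t := \int[mu]_w (A w * cosk (t, w)).
Let st A t := \int[mu]_w (A w * sink (t, w)).

Variable T : R.
Hypothesis T0 : 0 < T.

Let I : set R := centered_itv T.

Let intI : intg (\1_I). Proof. exact: intg_indic_itv. Qed.

(** This is [sin (pi u T) / (pi u)], extended by [T] at [u = 0]. The integral
    form settles the value at 0 and measurability at once. *)
Definition sinc_kernel u : R := ctrans (\1_(centered_itv T)) (fun=> 0) u.

Let intg0 : intg (fun=> 0 : R).
Proof. exact: integrable0. Qed.

Lemma measurable_sinc_kernel : measurable_fun setT sinc_kernel.
Proof. exact: measurable_ctrans. Qed.

Lemma sinc_kernelE u :
  sinc_kernel u = \int[mu]_t (\1_I t * cos (2 * pi * u * t)).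
Proof. by apply: eq_Rintegral => t _; rewrite mul0r addr0. Qed.

Lemma sinc_kernel_le u : `|sinc_kernel u| <= \int[mu]_t \1_I t.
Proof.
have intc := intg_mul_cos0 _ (2 * pi * u) intI.
rewrite sinc_kernelE; apply: le_trans (le_normr_Rintegral measurableT intc) _.
apply: le_Rintegral => //; first exact: integrable_norm.
move=> t _; rewrite normrM ger0_norm ?indicE// ler_piMr//.
exact: cos_max.
Qed.

(** By evenness [u] may be taken positive; the value is then a positive multiple
    of [sin (pi u T)], with [pi u T] between 0 and [pi] *)
Lemma sinc_kernel_ge0 u : `|u| * T <= 1 -> 0 <= sinc_kernel u.
Proof.
move=> uT; have -> : sinc_kernel u = sinc_kernel `|u|.
  rewrite !sinc_kernelE; apply: eq_Rintegral => t _; congr (_ * _).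
  have [u0|u0] := lerP 0 u; first by rewrite ger0_norm.
  by rewrite ltr0_norm// mulrN mulNr cosN.
rewrite sinc_kernelE Rintegral_indic.
have [->|u0] := eqVneq u 0.
  by apply: Rintegral_ge0 => t _; rewrite normr0 mulr0 mul0r cos0.
have c0 : 0 < 2 * pi * `|u| by rewrite !mulr_gt0 ?pi_gt0 ?normr_gt0.
set c := 2 * pi * `|u| in c0 *.
pose F t : R := c^-1 * sin (c * t).
have dF t : is_derive t (1 : R) F (cos (c * t)).
  have h := @is_derive1_comp R sin (fun x => c * x) t _ _ (is_derive_sin _)
    (is_derive_scale c t).
  apply: (is_derive_eq (is_derive_mull c^-1 _ _ t h)).
  by field; rewrite gt_eqF.
have cF t : {for t, continuous F}.
  by apply/differentiable_continuous/derivable1_diffP; have [] := dF t.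
rewrite /I /centered_itv /Rintegral (@continuous_FTC2 _ _ F)//.
- rewrite -EFinB/= /F mulrN sinN mulrN opprK.
  have s0 : 0 <= sin (c * (T / 2)).
    apply: sin_ge0_pi; apply/andP; split; first by rewrite mulr_ge0 ?divr_ge0// ltW.
    have -> : c * (T / 2) = pi * (`|u| * T) by rewrite /c; move: (pi : R) => q; field.
    by rewrite ler_piMr// pi_ge0.
  by rewrite addr_ge0// mulr_ge0// invr_ge0 ltW.
- by rewrite gtrN// divr_gt0.
- apply: continuous_subspaceT => x; apply: continuous_comp; last exact: continuous_cos.
  by apply: cvgM; [exact: cvg_cst|exact: cvg_id].
- split.
  + by move=> x _; have [] := dF x.
  + by apply: cvg_at_right_filter; exact: cF.
  + by apply: cvg_at_left_filter; exact: cF.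
- by move=> x _; rewrite derive1E; have [] := dF x.
Qed.

Let intg_sinc_form E : intg E ->
  intg (fun w => E w * \int[mu]_v (E v * sinc_kernel (w - v))).
Proof.
move=> intE.
apply: (intg_kernel E E (fun z => sinc_kernel (z.1 - z.2)) (\int[mu]_t \1_I t)) => //.
  by apply: measurableT_comp measurable_sinc_kernel _; exact: measurable_funB.
by move=> z; exact: sinc_kernel_le.
Qed.

Let intIct A : intg A -> intg (fun t => \1_I t * ct A t).
Proof. by move=> intA; exact: (intg_kernel _ A cosk 1). Qed.

Let intIst A : intg A -> intg (fun t => \1_I t * st A t).
Proof. by move=> intA; exact: (intg_kernel _ A sink 1). Qed.

(** [cos x * cos y + sin x * sin y = cos (x - y)] *)
Let quadratic_form A : intg A ->
  \int[mu]_t (\1_I t * ct A t * ct A t) + \int[mu]_t (\1_I t * st A t * st A t) =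
  \int[mu]_w (A w * \int[mu]_v (A v * sinc_kernel (w - v))).
Proof.
move=> intA.
have [-> ic1 ic2] := kernel_form _ _ _ _ _ intI intA intA mcosk mcosk cosk1 cosk1.
have [-> is1 is2] := kernel_form _ _ _ _ _ intI intA intA msink msink sink1 sink1.
rewrite -(RintegralTD _ _ ic1 is1); apply: eq_Rintegral => w _.
rewrite -mulrDr -(RintegralTD _ _ (ic2 w) (is2 w)); congr (_ * _); apply: eq_Rintegral => v _.
rewrite -mulrDr sinc_kernelE; congr (_ * _).
have intIk (k1 k2 : R * R -> R) : measurable_fun setT k1 -> measurable_fun setT k2 ->
    (forall z, `|k1 z| <= 1) -> (forall z, `|k2 z| <= 1) ->
    intg (fun t => \1_I t * k1 (t, w) * k2 (t, v)).
  move=> m1 m2 b1 b2; apply: (@intg_bounded_mul _ _ _ 1) => //; last first.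
    by apply: measurableT_comp m2 _; exact: measurable_pair2.
  apply: (@intg_bounded_mul _ _ _ 1) => //.
  by apply: measurableT_comp m1 _; exact: measurable_pair2.
rewrite -RintegralTD; [|exact: intIk..].
apply: eq_Rintegral => t _; rewrite /cosk /sink/=.
have -> : 2 * pi * (w - v) * t = 2 * pi * t * w - 2 * pi * t * v by ring.
by rewrite cosB; ring.
Qed.

(** The sine transform is odd and the cosine transform even, while the interval
    is symmetric: this decouples the real and imaginary parts of the spectrum *)
Let cross_form A B : intg A -> intg B ->
  intg (fun t => \1_I t * st A t * ct B t) /\
  \int[mu]_t (\1_I t * st A t * ct B t) = 0.
Proof.
move=> intA intB.
have int1 : intg (fun t => \1_I t * st A t * ct B t).
  by apply: (intg_kernel _ B cosk 1) => //; exact: intIst.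
split => //; apply: Rintegral_odd => // t.
have -> : st A (- t) = - st A t.
  rewrite -[RHS]mulN1r /st -RintegralTZl.
    apply: eq_Rintegral => w _.
    by rewrite /sink/= mulrN mulNr sinN; ring.
  apply: (@intg_bounded_mul _ _ _ 1) => //.
  by apply: measurableT_comp msink _; exact: measurable_pair1.
have -> : ct B (- t) = ct B t.
  by apply: eq_Rintegral => w _; rewrite /cosk/= mulrN mulNr cosN.
have -> : \1_I (- t) = \1_I t :> R.
  rewrite !indicE; congr (_ %:R); congr nat_of_bool; apply/idP/idP;
    rewrite !inE /I/centered_itv/= !in_itv/= => /andP[h1 h2]; apply/andP; split; lra.
by ring.
Qed.

(** Expanding the squares of [ct A - st B] and [ct B + st A] leaves two
    quadratic forms and two cross terms that vanish *)
Lemma energy_form A B : intg A -> intg B ->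
  \int[mu]_(t in centered_itv T) (ctrans A (\- B) t ^+ 2 + ctrans B A t ^+ 2) =
  \int[mu]_w (A w * (\int[mu]_v (A v * sinc_kernel (w - v))) +
              B w * (\int[mu]_v (B v * sinc_kernel (w - v)))).
Proof.
move=> intA intB.
rewrite RintegralTD; [|exact: intg_sinc_form..].
rewrite -!quadratic_form// -Rintegral_indic.
have icc E : intg E -> intg (fun t => \1_I t * ct E t * ct E t).
  by move=> intE; apply: (intg_kernel _ E cosk 1) => //; exact: intIct.
have iss E : intg E -> intg (fun t => \1_I t * st E t * st E t).
  by move=> intE; apply: (intg_kernel _ E sink 1) => //; exact: intIst.
have [ixAB xAB] := cross_form A B intA intB.
have [ixBA xBA] := cross_form B A intB intA.
have iA : intg (fun t => \1_I t * ct A t * ct A t + \1_I t * st A t * st A t).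
  by apply: intgD; [exact: icc|exact: iss].
have iB : intg (fun t => \1_I t * ct B t * ct B t + \1_I t * st B t * st B t).
  by apply: intgD; [exact: icc|exact: iss].
have iX : intg (fun t => 2 * (\1_I t * st A t * ct B t) - 2 * (\1_I t * st B t * ct A t)).
  by apply: intgB; exact: intgZ.
have X0 : \int[mu]_t (2 * (\1_I t * st A t * ct B t) - 2 * (\1_I t * st B t * ct A t)) = 0.
  by rewrite RintegralTB; [|exact: intgZ..]; rewrite !RintegralTZl// xAB xBA; ring.
rewrite -(RintegralTD _ _ (icc A intA) (iss A intA)).
rewrite -(RintegralTD _ _ (icc B intB) (iss B intB)).
rewrite -(RintegralTD _ _ iA iB) -[RHS]addr0 -X0.
rewrite -(RintegralTD _ _ (intgD _ _ iA iB) iX).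
apply: eq_Rintegral => t _.
rewrite !ctransE//; last exact: intgN.
have -> : \int[mu]_x ((\- B) x * sin (2 * pi * t * x)) = - st B t.
  rewrite -[RHS]mulN1r /st -RintegralTZl; last exact: (intg_mul_sin0 B (2 * pi * t) intB).
  by apply: eq_Rintegral => x _ /=; rewrite mulN1r mulNr.
rewrite -/(ct A t) -/(ct B t) -/(st A t).
ring.
Qed.

Let sqr_sum_eq0 x u : x ^+ 2 + u ^+ 2 = 0 -> x = 0 /\ u = 0.
Proof.
move=> /eqP; rewrite paddr_eq0 ?sqr_ge0// !sqrf_eq0.
by move=> /andP[/eqP -> /eqP ->].
Qed.

(** By the Cauchy-Schwarz inequality in the plane,
    [A w * A v + B w * B v <= C w * C v], and this survives integration against a
    kernel that is nonnegative on differences of points of [J] *)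
Lemma energy_form_le A B C D (J : set R) :
  intg A -> intg B -> intg C -> intg D ->
  (forall w v, J w -> J v -> 0 <= sinc_kernel (w - v)) ->
  {ae mu, forall w, A w ^+ 2 + B w ^+ 2 = C w ^+ 2} ->
  {ae mu, forall w, 0 <= C w} -> {ae mu, forall w, D w = 0} ->
  {ae mu, forall w, ~ J w -> C w = 0} ->
  \int[mu]_w (A w * (\int[mu]_v (A v * sinc_kernel (w - v))) +
              B w * (\int[mu]_v (B v * sinc_kernel (w - v)))) <=
  \int[mu]_w (C w * (\int[mu]_v (C v * sinc_kernel (w - v))) +
              D w * (\int[mu]_v (D v * sinc_kernel (w - v)))).
Proof.
move=> intA intB intC intD K0 ABC C0 D0 CJ.
have intK E w : intg E -> intg (fun v => E v * sinc_kernel (w - v)).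
  move=> intE; apply: (@intg_bounded_mul _ _ _ (\int[mu]_t \1_I t)) => //.
    by apply: measurableT_comp measurable_sinc_kernel _; exact: measurable_funB.
  by move=> v; exact: sinc_kernel_le.
have good : {ae mu, forall w, [/\ A w ^+ 2 + B w ^+ 2 = C w ^+ 2, 0 <= C w, D w = 0 &
    ~ J w -> C w = 0]}.
  apply: ae_mono (ae_and _ _ (ae_and _ _ ABC C0) (ae_and _ _ D0 CJ)).
  by move=> w [[? ?] [? ?]].
apply: ae_le_Rintegral; [by apply: intgD; exact: intg_sinc_form..|].
apply: ae_mono (good) => w [ABCw Cw0 Dw0 CJw]; rewrite Dw0 mul0r addr0.
have [Jw|nJw] := pselect (J w); last first.
  have Cw := CJw nJw; rewrite Cw mul0r.
  have [|-> ->] := sqr_sum_eq0 (A w) (B w); last by rewrite !mul0r addr0.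
  by rewrite ABCw Cw expr0n.
rewrite -!RintegralTZl; [|exact: intK..].
rewrite -RintegralTD; [|exact/intgZ/intK..].
apply: ae_le_Rintegral.
- by apply: intgD; exact/intgZ/intK.
- exact/intgZ/intK.
apply: ae_mono (good) => v [ABCv Cv0 Dv0 CJv].
have ABle : A w * A v + B w * B v <= C w * C v.
  have CC : 0 <= C w * C v by exact: mulr_ge0.
  have [neg|pos] := lerP (A w * A v + B w * B v) 0; first exact: le_trans neg CC.
  rewrite -(@ler_pXn2r _ 2) ?nnegrE// ?(ltW pos)//.
  rewrite exprMn -ABCw -ABCv.
  have : 0 <= (A w * B v - B w * A v) ^+ 2 by exact: sqr_ge0.
  lra.
rewrite !mulrA -mulrDl.
have [Jv|nJv] := pselect (J v).
  by apply: ler_wpM2r => //; exact: K0.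
have Cv := CJv nJv; rewrite Cv mulr0.
have [|-> ->] := sqr_sum_eq0 (A v) (B v); last by rewrite !mulr0 addr0 !mul0r.
by rewrite ABCv Cv expr0n.
Qed.

End Energy.

(** * From complex functions to real and imaginary parts *)

Section Bridge.
Context {R : realType}.
Local Notation mu := (@lebesgue_measure R).
Local Notation intg f := (mu.-integrable setT (EFin \o f)).
Implicit Types (f g F G u : R -> R[i]) (t w : R) (z : R[i]).

Local Notation re f := (fun t => complex.Re (f t)).
Local Notation im f := (fun t => complex.Im (f t)).

Lemma sqr_normc z : Normc.normc z ^+ 2 = complex.Re z ^+ 2 + complex.Im z ^+ 2.
Proof. by case: z => x y; rewrite /= sqr_sqrtr// addr_ge0// sqr_ge0. Qed.

Lemma measurable_sqr_normc (D : set R) f : cmeasurable_fun D f ->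
  measurable_fun D (fun t => Normc.normc (f t) ^+ 2).
Proof.
move=> [mr mi]; under eq_fun do rewrite sqr_normc.
by apply: measurable_funD; exact: measurable_funX.
Qed.

Lemma Re_energy_le f : cmeasurable_fun setT f ->
  (\int[mu]_t ((complex.Re (f t)) ^+ 2)%:E <= energy setT f)%E.
Proof.
move=> mf; apply: ge0_le_integral => //.
- by move=> t _; rewrite lee_fin sqr_ge0.
- by apply/measurable_EFinP; apply: measurable_funX; have [] := mf.
- by apply/measurable_EFinP; exact: measurable_sqr_normc.
- by move=> t _; rewrite lee_fin sqr_normc lerDl sqr_ge0.
Qed.

Lemma Im_energy_le f : cmeasurable_fun setT f ->
  (\int[mu]_t ((complex.Im (f t)) ^+ 2)%:E <= energy setT f)%E.
Proof.
move=> mf; apply: ge0_le_integral => //.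
- by move=> t _; rewrite lee_fin sqr_ge0.
- by apply/measurable_EFinP; apply: measurable_funX; have [] := mf.
- by apply/measurable_EFinP; exact: measurable_sqr_normc.
- by move=> t _; rewrite lee_fin sqr_normc lerDr sqr_ge0.
Qed.

Lemma L2_intg_sqr f : L2 setT f ->
  [/\ measurable_fun setT (re f), measurable_fun setT (im f),
      intg (fun t => complex.Re (f t) ^+ 2) & intg (fun t => complex.Im (f t) ^+ 2)].
Proof.
move=> [mf foo]; have [mr mi] := mf; split => //.
- apply: intgP; [exact: measurable_funX|by move=> t; exact: sqr_ge0|].
  exact: le_lt_trans (Re_energy_le _ mf) foo.
- apply: intgP; [exact: measurable_funX|by move=> t; exact: sqr_ge0|].
  exact: le_lt_trans (Im_energy_le _ mf) foo.
Qed.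

Lemma Re_fourier_integral u w :
  complex.Re (fourier_integral u w) = ctrans (re u) (im u) w.
Proof.
apply: eq_Rintegral => t _; rewrite /cexpi cosN sinN /=.
by case: (u t) => a b /=; ring.
Qed.

Lemma Im_fourier_integral u w :
  complex.Im (fourier_integral u w) = ctrans (im u) (\- re u) w.
Proof.
apply: eq_Rintegral => t _; rewrite /cexpi cosN sinN /=.
by case: (u t) => a b /=; ring.
Qed.

Lemma ReB z1 z2 : complex.Re (z1 - z2) = complex.Re z1 - complex.Re z2.
Proof. by case: z1 z2 => [? ?] [? ?]. Qed.

Lemma ImB z1 z2 : complex.Im (z1 - z2) = complex.Im z1 - complex.Im z2.
Proof. by case: z1 z2 => [? ?] [? ?]. Qed.

Lemma cvg_energy_parts (v : nat -> R -> R[i]) f :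
  (forall n, cmeasurable_fun setT (v n)) -> cmeasurable_fun setT f ->
  (fun n => energy setT (fun t => v n t - f t)) @ \oo --> (0 : \bar R)%E ->
  (\int[mu]_t ((complex.Re (v n t) - complex.Re (f t)) ^+ 2)%:E)%E @[n --> \oo]
    --> (0 : \bar R)%E /\
  (\int[mu]_t ((complex.Im (v n t) - complex.Im (f t)) ^+ 2)%:E)%E @[n --> \oo]
    --> (0 : \bar R)%E.
Proof.
move=> mv [mr mi] v0.
have mvf n : cmeasurable_fun setT (fun t => v n t - f t).
  have [vr vi] := mv n; split.
    by under eq_fun do rewrite ReB; exact: measurable_funB.
  by under eq_fun do rewrite ImB; exact: measurable_funB.
split; apply: (squeeze_cvge _ _ v0); try exact: cvg_cst; apply: nearW => n.
- rewrite integral_ge0/=; last by move=> t _; rewrite lee_fin sqr_ge0.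
  apply: le_trans (Re_energy_le _ (mvf n)).
  by under eq_integral do rewrite -ReB.
- rewrite integral_ge0/=; last by move=> t _; rewrite lee_fin sqr_ge0.
  apply: le_trans (Im_energy_le _ (mvf n)).
  by under eq_integral do rewrite -ImB.
Qed.

(** The second half is the first one for [- 'i * f], whose transform is
    [- 'i * F]: the approximating functions [u n] are multiplied by [- 'i] too *)
Lemma is_fourier_L2_spectrum f F : is_fourier f F ->
  L2_spectrum (re f) (re F) (im F) /\ L2_spectrum (im f) (im F) (\- re F).
Proof.
move=> [L2f L2F [u [iu uf uF]]].
have [mrf mif rf2 if2] := L2_intg_sqr _ L2f.
have [mrF miF rF2 iF2] := L2_intg_sqr _ L2F.
have ire n : intg (re (u n)) by have [[]] := iu n.
have iim n : intg (im (u n)) by have [[]] := iu n.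
have mu_ n : cmeasurable_fun setT (u n).
  by split; exact: intg_measurable.
have mfu n : cmeasurable_fun setT (fourier_integral (u n)).
  split.
    under eq_fun do rewrite Re_fourier_integral.
    exact: measurable_ctrans.
  under eq_fun do rewrite Im_fourier_integral.
  by apply: measurable_ctrans => //; exact: intgN.
have [ufr ufi] := cvg_energy_parts _ _ mu_ (conj mrf mif) uf.
have [uFr uFi] := cvg_energy_parts _ _ mfu (conj mrF miF) uF.
have ctransN (a b : R -> R) w : intg a -> intg b ->
    ctrans (\- a) (\- b) w = - ctrans a b w.
  move=> inta intb; rewrite /ctrans -[RHS]mulN1r -RintegralTZl.
    by apply: eq_Rintegral => t _ /=; ring.
  by apply: intgD; [exact: intg_mul_cos0|exact: intg_mul_sin0].
split; split.
- by [].
- by [].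
- exists (fun n => re (u n)), (fun n => im (u n)); split.
  + by move=> n; split.
  + exact: ufr.
  + apply: cvg_trans uFr; apply: near_eq_cvg; apply: nearW => n.
    by apply: eq_integral => w _; rewrite Re_fourier_integral.
  + apply: cvg_trans uFi; apply: near_eq_cvg; apply: nearW => n.
    by apply: eq_integral => w _; rewrite Im_fourier_integral.
- by split => //; exact: measurableT_comp.
- by split => //; apply: eq_integrable rF2 => // w _ /=; rewrite sqrrN.
- exists (fun n => im (u n)), (fun n => \- re (u n)); split.
  + by move=> n; split => //; exact: intgN.
  + exact: ufi.
  + apply: cvg_trans uFi; apply: near_eq_cvg; apply: nearW => n.
    by apply: eq_integral => w _; rewrite Im_fourier_integral.
  + apply: cvg_trans uFr; apply: near_eq_cvg; apply: nearW => n.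
    apply: eq_integral => w _; congr EFin; rewrite Re_fourier_integral ctransN//.
    by rewrite /=; ring.
Qed.

Lemma ae_eq_intg (a b : R -> R) : measurable_fun setT a -> intg b ->
  {ae mu, forall x, a x = b x} -> intg a.
Proof.
move=> ma intb ab; have mb := intg_measurable _ intb.
apply/integrableP; split; first exact/measurable_EFinP.
have -> : (\int[mu]_x `|(EFin \o a) x| = \int[mu]_x `|(EFin \o b) x|)%E.
  apply: ge0_ae_eq_integral => //.
  - by apply: measurableT_comp => //; exact/measurable_EFinP.
  - by apply: measurableT_comp => //; exact/measurable_EFinP.
  - by apply: ae_mono ab => x /= ->.
by case/integrableP : intb.
Qed.

(** The function equals its product with the indicator of [J], which is
    square-integrable *)
Lemma intg_sqr_finite_support (a : R -> R) (J : set R) : measurable J ->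
  (mu J < +oo)%E -> measurable_fun setT a -> intg (fun x => a x ^+ 2) ->
  {ae mu, forall x, ~ J x -> a x = 0} -> intg a.
Proof.
move=> mJ Joo ma a2 aJ.
have mI : measurable_fun setT (\1_J : R -> R) by exact: measurable_indic.
have I2 : intg (fun x => (\1_J x : R) ^+ 2).
  apply: intgP; first exact: measurable_funX.
    by move=> x; exact: sqr_ge0.
  have -> : (fun x => ((\1_J x : R) ^+ 2)%:E) = (fun x => (\1_J x)%:E).
    by apply/funext => x; rewrite indicE; case: (_ \in _); rewrite ?expr1n ?expr0n.
  by rewrite integral_indic// setIT.
apply: (ae_eq_intg a (fun x => \1_J x * a x)) => //; first exact: intg_mul.
apply: ae_mono aJ => x; rewrite indicE; have [xJ _|xJ ->] := boolP (x \in J).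
- by rewrite mul1r.
- by rewrite mulr0.
- by move: xJ; rewrite notin_setE.
Qed.

(** The segment on which inversion is applied exceeds the centered interval by 1
    on each side, because inversion is stated on an open interval *)
Lemma energy_spectrum f F T (J : set R) : 0 < T -> measurable J ->
  (mu J < +oo)%E -> is_fourier f F -> {ae mu, forall w, ~ J w -> F w = 0} ->
  [/\ intg (re F), intg (im F) &
  energy (centered_itv T) f =
  (\int[mu]_w
     (complex.Re (F w) * (\int[mu]_v (complex.Re (F v) * sinc_kernel T (w - v))) +
      complex.Im (F w) * (\int[mu]_v (complex.Im (F v) * sinc_kernel T (w - v)))))%:E].
Proof.
move=> T0 mJ Joo fF FJ.
have [_ L2F _] := fF; have [L2f _ _] := fF.
have [mrf mif rf2 if2] := L2_intg_sqr _ L2f.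
have [mrF miF rF2 iF2] := L2_intg_sqr _ L2F.
have [specr speci] := is_fourier_L2_spectrum _ _ fF.
have irF : intg (re F).
  by apply: (intg_sqr_finite_support _ J) => //; apply: ae_mono FJ => w /[apply] ->.
have iiF : intg (im F).
  by apply: (intg_sqr_finite_support _ J) => //; apply: ae_mono FJ => w /[apply] ->.
split => //; rewrite -energy_form//.
have invr := spectrum_inversion _ _ _ (- (T / 2) - 1) (T / 2 + 1) specr irF iiF.
have invi := spectrum_inversion _ _ _ (- (T / 2) - 1) (T / 2 + 1) speci iiF (intgN _ irF).
have eqI : (energy (centered_itv T) f = \int[mu]_(t in centered_itv T)
    (ctrans (re F) (\- im F) t ^+ 2 + ctrans (im F) (re F) t ^+ 2)%:E)%E.
  apply: ge0_ae_eq_integral.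
  - exact: measurable_itv.
  - apply/measurable_EFinP; apply: measurable_funTS.
    by apply: measurable_sqr_normc; exact: L2f.1.
  - apply/measurable_EFinP; apply: measurable_funTS; apply: measurable_funD.
      by apply: measurable_funX; apply: measurable_ctrans => //; exact: intgN.
    by apply: measurable_funX; exact: measurable_ctrans.
  - by move=> t _; rewrite lee_fin sqr_ge0.
  - by move=> t _; rewrite lee_fin addr_ge0// sqr_ge0.
  - apply: ae_mono (ae_and _ _ invr invi) => t /= [rE iE].
    rewrite /centered_itv/= in_itv/= => /andP[t1 t2].
    have tin : t \in `](- (T / 2) - 1), (T / 2 + 1)[.
      by rewrite in_itv/=; apply/andP; split; lra.
    rewrite sqr_normc rE// iE//; congr (_ + _ ^+ 2)%:E.
    congr ctrans; apply/funext => w /=; exact: opprK.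
rewrite eqI /Rintegral fineK// -eqI ge0_fin_numE; last first.
  by apply: integral_ge0 => t _; rewrite lee_fin sqr_ge0.
have [mf foo] := L2f; apply: le_lt_trans foo.
apply: ge0_subset_integral => //.
- exact: measurable_itv.
- by apply/measurable_EFinP; exact: measurable_sqr_normc.
- by move=> t _; rewrite lee_fin sqr_ge0.
Qed.

Lemma itv_dist_le (J : interval R) (W : R) w t : mu [set` J] = W%:E ->
  [set` J] w -> [set` J] t -> `|w - t| <= W.
Proof.
move=> hW; wlog wt : w t / w <= t.
  move=> h Jw Jt; have [wt|tw] := leP w t; first exact: h.
  by rewrite distrC; apply: h => //; exact: ltW.
move=> Jw Jt; rewrite distrC ger0_norm ?subr_ge0//.
move: wt; rewrite le_eqVlt => /predU1P[->|wt].
  by rewrite subrr -lee_fin -hW measure_ge0.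
rewrite -lee_fin -hW; have -> : (t - w)%:E = mu `[w, t]%classic.
  by rewrite lebesgue_measure_itv/= lte_fin wt EFinB.
apply: le_measure; rewrite ?inE; [exact: measurable_itv..|].
move=> x /=; rewrite in_itv/= => xwt.
exact: (@interval_is_interval _ J w t Jw Jt).
Qed.

End Bridge.


(** * Maximality of the constant phase *)

Theorem theorem2p2 (R : realType) (J : interval R) (W T : R)
    (hW : lebesgue_measure [set` J] = W%:E) (hT : 0 < T) (hWT : W * T <= 1)
    (h : R -> R) (hL2 : L2 [set` J] (fun w => (h w)%:C))
    (h_ge0 : {ae @lebesgue_measure R, forall w, [set` J] w -> 0 <= h w})
    (g : R -> R[i]) (gPW : PW [set` J] g)
    (gh : exists G, is_fourier g G /\
      {ae @lebesgue_measure R, forall w, G w = (zero_ext [set` J] h w)%:C}) :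
  spectral_class [set` J] h g /\
  forall f : R -> R[i], spectral_class [set` J] h f ->
    (energy (centered_itv T) f <= energy (centered_itv T) g)%E.
Proof.
have [G [gG Gh]] := gh.
have gA : spectral_class [set` J] h g.
  split=> //; exists G; split=> //.
  apply: ae_mono (ae_and _ _ Gh h_ge0) => w [-> hw]; rewrite /zero_ext patchE.
  have [wJ|_] := boolP (w \in _).
    by rewrite /= expr0n/= addr0 sqrtr_sqr ger0_norm//; apply: hw; rewrite inE in wJ.
  by rewrite /= expr0n/= addr0 sqrtr0.
split=> // f [_ [F [fF Fh]]].
have mJ : measurable [set` J] by exact: measurable_itv.
have Joo : (lebesgue_measure [set` J] < +oo)%E by rewrite hW ltry.
have zJ w : ~ [set` J] w -> zero_ext [set` J] h w = 0.
  by move=> nJ; rewrite /zero_ext patchE memNset.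
have FJ : {ae lebesgue_measure, forall w, ~ [set` J] w -> F w = 0}.
  apply: ae_mono Fh => w Fw nJ; have := Fw; rewrite zJ//.
  exact: Normc.eq0_normc.
have GJ : {ae lebesgue_measure, forall w, ~ [set` J] w -> G w = 0}.
  by apply: ae_mono Gh => w Gw nJ; rewrite Gw zJ.
have [irF iiF ->] := energy_spectrum _ _ _ _ hT mJ Joo fF FJ.
have [irG iiG ->] := energy_spectrum _ _ _ _ hT mJ Joo gG GJ.
rewrite lee_fin; apply: (energy_form_le _ _ _ _ _ [set` J]) => //.
- move=> w v Jw Jv; apply: sinc_kernel_ge0 => //.
  apply: le_trans hWT; apply: ler_wpM2r; first exact: ltW.
  exact: itv_dist_le hW Jw Jv.
- apply: ae_mono (ae_and _ _ Fh Gh) => w [Fw ->].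
  by rewrite -sqr_normc Fw.
- apply: ae_mono (ae_and _ _ h_ge0 Gh) => w [hw ->] /=.
  by rewrite /zero_ext patchE; case: ifPn => // /set_mem; exact: hw.
- by apply: ae_mono Gh => w ->.
- by apply: ae_mono GJ => w /[apply] ->.
Qed.
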